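(* Let $\Lambda=\{(x_1,x_2,x_3)\in\mathbb R^3: x_3=x_1^2+x_2^2\}$. Then $\left(S^2,\Lambda\right)$ is a Heisenberg uniqueness pair with respect to $L^1_{\text{sym}}(S^2)$; that is, if $f\in L^1_{\text{sym}}(S^2)$, $d\mu=f\,d\sigma$, and $\hat\mu(\xi)=0$ for all $\xi\in\Lambda$, then $\mu=0$.
   Context: $S^2$ is the unit sphere in $\mathbb R^3$ and $d\sigma$ is its normalized surface measure. For $d\mu=f\,d\sigma$ with $f\in L^1(S^2)$, $\hat\mu(\xi)=\int_{S^2}e^{-i\xi\cdot\eta}f(\eta)\,d\sigma(\eta)$ for $\xi\in\mathbb R^3$. Use spherical polar coordinates $\eta=(\sin\theta\cos\varphi,\sin\theta\sin\varphi,\cos\theta)$ with $\theta\in[0,\pi]$, $\varphi\in[0,2\pi)$. For integers $k\ge0$ and $-k\le l\le k$ put $Y_k^l(\theta,\varphi)=e^{il\varphi}P_k^l(\cos\theta)$, where $P_k^l$ are the associated Legendre functions of degree $k$ and order $l$, each normalized by a positive constant so that $\{Y_k^l:-k\le l\le k\}$ is an orthonormal basis of the space of spherical harmonics of degree $k$ on $S^2$ (with respect to $d\sigma$). For $f\in L^1(S^2)$ let $C_k^l(f)=\int_{S^2}f\,\overline{Y_k^l}\,d\sigma$ be the coefficients in its spherical harmonic expansion $\sum_{k=0}^\infty\sum_{l=-k}^kC_k^l(f)e^{il\varphi}P_k^l(\cos\theta)$. $L^1_{\text{sym}}(S^2)$ is the space of all $f\in L^1(S^2)$ such that $C_k^l(f)=C_{k'}^l(f)$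 for all integers $k,k'\ge0$ and all integers $l$ with $|l|\le\min\{k,k'\}$. *)

(* Defs.v *)
From HB Require Import structures.
From mathcomp Require Import all_boot all_order all_algebra.
From mathcomp Require Import all_classical all_reals all_analysis.
From mathcomp Require Import measurable_realfun complex.

Set Implicit Arguments.
Unset Strict Implicit.
Unset Printing Implicit Defensive.
Import Order.TTheory GRing.Theory Num.Theory.
Import numFieldNormedType.Exports.
Local Open Scope classical_set_scope.
Local Open Scope ring_scope.

Section complex_functions.
Context {R : realType}.

Definition expi (x : R) : R[i] := Complex (cos x) (sin x).

Section integration.
Context {d : measure_display} {T : measurableType d}.
Variable mu : {measure set T -> \bar R}.

Definition cintegrable (D : set T) (f : T -> R[i]) : Prop :=
  mu.-integrable D (fun x => (complex.Re (f x))%:E) /\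
  mu.-integrable D (fun x => (complex.Im (f x))%:E).

Definition cintegral (D : set T) (f : T -> R[i]) : R[i] :=
  Complex (\int[mu]_(x in D) complex.Re (f x))
          (\int[mu]_(x in D) complex.Im (f x)).

End integration.
End complex_functions.

(* The sphere S^2 lives in R^3 = (R * R) * R with its product sigma-algebra;
   a function on S^2 is a function on R^3 of which only the restriction to
   [sphere] is ever used. *)
Section sphere.
Context {R : realType}.
Local Notation R2 := (measurableTypeR R * measurableTypeR R)%type.
Local Notation R3 := (R * R * R)%type.

Definition dot3 (x y : R3) : R :=
  x.1.1 * y.1.1 + x.1.2 * y.1.2 + x.2 * y.2.

Definition sphere : set R3 := [set x | dot3 x x = 1].

(* Pairs (theta, phi) in [0, pi] x [0, 2 pi[; [measurableTypeR R] is the copy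
   of R on which [lebesgue_measure] is defined. *)
Definition polar_dom : set R2 := `[0, pi] `*` `[0, 2 * pi[.

Definition polar (t : R2) : R3 :=
  (sin t.1 * cos t.2, sin t.1 * sin t.2, cos t.1).

Definition polar_density (t : R2) : R := sin t.1 / (4 * pi).

(* sin(theta) dtheta dphi / (4 pi) on [polar_dom], of total mass 1. *)
Definition polar_measure (A : set R2) : \bar R :=
  (\int[(@lebesgue_measure R) \x (@lebesgue_measure R)]_(t in A `&` polar_dom)
    (polar_density t)%:E)%E.

Let measurable_sin1 : measurable_fun setT (fun t : R2 => sin t.1 : R).
Proof.
apply: (@measurableT_comp _ _ _ _ _ _ (sin : measurableTypeR R -> R)).
  exact: (continuous_measurable_fun (@continuous_sin R)).
exact: measurable_fst.
Qed.

Let measurable_sin2 : measurable_fun setT (fun t : R2 => sin t.2 : R).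
Proof.
apply: (@measurableT_comp _ _ _ _ _ _ (sin : measurableTypeR R -> R)).
  exact: (continuous_measurable_fun (@continuous_sin R)).
exact: measurable_snd.
Qed.

Let measurable_cos1 : measurable_fun setT (fun t : R2 => cos t.1 : R).
Proof.
apply: (@measurableT_comp _ _ _ _ _ _ (cos : measurableTypeR R -> R)).
  exact: (continuous_measurable_fun (@continuous_cos R)).
exact: measurable_fst.
Qed.

Let measurable_cos2 : measurable_fun setT (fun t : R2 => cos t.2 : R).
Proof.
apply: (@measurableT_comp _ _ _ _ _ _ (cos : measurableTypeR R -> R)).
  exact: (continuous_measurable_fun (@continuous_cos R)).
exact: measurable_snd.
Qed.

Lemma measurable_polar_dom : measurable polar_dom.
Proof. by apply: measurableX. Qed.

Lemma measurable_polar_density : measurable_fun setT polar_density.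
Proof. exact: measurable_funM. Qed.

Lemma polar_density_ge0 (t : R2) : polar_dom t -> 0 <= polar_density t.
Proof.
move=> [/= t1 _]; rewrite divr_ge0 ?mulr_ge0 ?pi_ge0//.
by apply: sin_ge0_pi; move: t1; rewrite in_itv.
Qed.

Let polar_measure0 : polar_measure set0 = 0%E.
Proof. by rewrite /polar_measure set0I integral_set0. Qed.

Let polar_measure_ge0 A : (0 <= polar_measure A)%E.
Proof. by apply: integral_ge0 => t [_ tD]; rewrite lee_fin polar_density_ge0. Qed.

Let polar_measure_sigma_additive : semi_sigma_additive polar_measure.
Proof.
move=> F mF tF mUF; rewrite /polar_measure; apply: cvg_toP.
  by apply: is_cvg_ereal_nneg_natsum => n _; exact: polar_measure_ge0.
rewrite setI_bigcupl ge0_integral_bigcup//.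
- by move=> n; apply: measurableI => //; exact: measurable_polar_dom.
- apply/measurable_EFinP; apply: measurable_funTS.
  exact: measurable_polar_density.
- by move=> t [n _ [_ tD]]; rewrite lee_fin polar_density_ge0.
- exact: trivIset_setIr.
Qed.

HB.instance Definition _ := isMeasure.Build _ _ _ polar_measure
  polar_measure0 polar_measure_ge0 polar_measure_sigma_additive.

Lemma measurable_polar : measurable_fun setT polar.
Proof.
by apply: measurable_fun_pair => //; apply: measurable_fun_pair => //;
  apply: measurable_funM.
Qed.

HB.instance Definition _ := isMeasurableFun.Build _ _ _ _ polar measurable_polar.

(* The normalized surface measure, written in spherical polar coordinates. *)
Definition sphere_measure : set R3 -> \bar R :=
  pushforward polar_measure polar.

Let sphere_measure0 : sphere_measure set0 = 0%E.
Proof. exact: measure0. Qed.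

Let sphere_measure_ge0 A : (0 <= sphere_measure A)%E.
Proof. exact: measure_ge0. Qed.

Let sphere_measure_sigma_additive : semi_sigma_additive sphere_measure.
Proof. exact: measure_semi_sigma_additive. Qed.

HB.instance Definition _ := isMeasure.Build _ _ _ sphere_measure
  sphere_measure0 sphere_measure_ge0 sphere_measure_sigma_additive.

End sphere.

Section spherical_harmonics.
Context {R : realType}.
Local Notation R3 := (R * R * R)%type.

(* Rodrigues' formula. *)
Definition legendre (k : nat) : {poly R} :=
  (2 ^+ k * k`!%:R)^-1 *: (('X^2 - 1) ^+ k)^`(k).

(* Condon-Shortley phase (-1)^m; as it does not depend on k, the choice of phase
   has no effect on [L1_sym]. *)
Definition ferrers (k m : nat) (x : R) : R :=
  (-1) ^+ m * Num.sqrt (1 - x ^+ 2) ^+ m * ((legendre k)^`(m)).[x].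

Definition assoc_legendre (k : nat) (l : int) (x : R) : R :=
  match l with
  | Posz m => ferrers k m x
  | Negz _ => (-1) ^+ `|l| * ((k - `|l|)`!%:R / (k + `|l|)`!%:R) *
              ferrers k `|l| x
  end.

Definition harmonic_of (P : R -> R) (l : int) (t : R * R) : R[i] :=
  expi (l%:~R * t.2) * (P (cos t.1))%:C%C.

(* The positive constant that gives Y_k^l norm 1 in L^2(S^2), for |l| <= k. *)
Definition legendre_norm (k : nat) (l : int) : R :=
  (Num.sqrt (\int[polar_measure]_(t in polar_dom)
     Normc.normc (harmonic_of (assoc_legendre k l) l t) ^+ 2))^-1.

Definition normalized_legendre (k : nat) (l : int) (x : R) : R :=
  legendre_norm k l * assoc_legendre k l x.

Definition sph_harmonic (k : nat) (l : int) : R * R -> R[i] :=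
  harmonic_of (normalized_legendre k l) l.

(* Since [sphere_measure] is the image of [polar_measure] under [polar], this
   is the integral of f times the conjugate of Y_k^l over S^2. *)
Definition harmonic_coef (k : nat) (l : int) (f : R3 -> R[i]) : R[i] :=
  cintegral polar_measure polar_dom (fun t => f (polar t) * conjc (sph_harmonic k l t)).

Definition L1_sphere : set (R3 -> R[i]) :=
  [set f | cintegrable sphere_measure sphere f].

Definition L1_sym : set (R3 -> R[i]) :=
  [set f | L1_sphere f /\
    forall (k k' : nat) (l : int), (`|l| <= minn k k')%N ->
      harmonic_coef k l f = harmonic_coef k' l f].

End spherical_harmonics.

Section heisenberg_uniqueness.
Context {R : realType}.
Local Notation R3 := (R * R * R)%type.

Definition density_measure (f : R3 -> R[i]) (A : set R3) : R[i] :=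
  cintegral sphere_measure (sphere `&` A) f.

Definition fourier_sphere (f : R3 -> R[i]) (xi : R3) : R[i] :=
  cintegral sphere_measure sphere (fun eta => expi (- dot3 xi eta) * f eta).

(* (S^2, Lambda) is a Heisenberg uniqueness pair with respect to X. *)
Definition heisenberg_uniqueness_pair
    (Lambda : set R3) (X : set (R3 -> R[i])) : Prop :=
  forall f, X f ->
    (forall xi, Lambda xi -> fourier_sphere f xi = 0) ->
    forall A, measurable A -> density_measure f A = 0.

Definition paraboloid : set R3 := [set x | x.2 = x.1.1 ^+ 2 + x.1.2 ^+ 2].

End heisenberg_uniqueness.

(* Main.v *)
Require Import Defs.
From mathcomp Require Import all_boot all_order all_algebra.
From mathcomp Require Import all_classical all_reals all_analysis.
From mathcomp Require Import measurable_realfun complex cauchyreals polyrcf.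
From mathcomp Require Import ring lra zify.

(** The Fourier transform on the paraboloid determines the lowest harmonic
    coefficients C_{|l|}^l of f, and the symmetry of f makes these determine all
    the others.

    Take the points xi = (r Re u, r Im u, r^2) of the paraboloid, with |u| = 1.
    With w = x + iy one has xi . eta = r Re (w / u) + r^2 z: the part of order r
    depends on u, the part of order r^2 does not. Average the transform against
    u^n, with u running over the N-th roots of unity for some N > 2n. In the
    Taylor expansion in r, a term Re (w / u)^a with a < n averages to 0, and the
    term with a = n averages to a multiple of w^n. As the transform vanishes,
    letting r tend to 0 gives that the integral of f w^n is 0
    ([vanishing_power_moment], [paraboloid_power_moments]); exchanging u and its
    conjugate gives the same with x - iy. On S^2, (x + iy)^m and (x - iy)^m are
    the conjugates of the harmonics Y_m^(-m) and Y_m^m up to nonzero factors, so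
    that C_{|l|}^l = 0 for all l, hence C_k^l = 0 for all k >= |l|
    ([harmonic_coef_eq0]).

    It remains to see that an integrable f with vanishing coefficients defines
    the zero measure. For fixed l the conjugates of the Y_k^l are (x - iy)^|l| or
    (x + iy)^|l| times polynomials in z of degrees 0, 1, 2, ..., so that every
    polynomial moment of f is 0 ([mixed_moment_eq0]). Since f is only integrable,
    one has to approximate indicator functions boundedly rather than in mean.
    The polynomials (1 - t^(2n))^(n 4^n) converge boundedly on [0, 1] to the
    indicator function of [0, 1/2[ ([cvg_step_poly]). Hence the bounded functions
    orthogonal to f times all monomials are stable under the product by
    indicator functions of half-spaces, and, as the sets with this stability
    form a sigma-algebra, by those of all Borel sets ([moment_uniqueness]). *)

Set Implicit Arguments.
Unset Strict Implicit.
Unset Printing Implicit Defensive.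
Import Order.TTheory GRing.Theory Num.Theory.
Import numFieldNormedType.Exports.
Local Open Scope classical_set_scope.
Local Open Scope ring_scope.

Local Notation normc := Normc.normc.
Local Notation Re := complex.Re.
Local Notation Im := complex.Im.

(** * Complex-valued integrals and bounded multipliers *)

Section complex_numbers.
Context {R : realType}.
Implicit Types x y z : R[i].

Lemma ReD x y : Re (x + y) = Re x + Re y. Proof. by case: x y => ? ? []. Qed.
Lemma ImD x y : Im (x + y) = Im x + Im y. Proof. by case: x y => ? ? []. Qed.
Lemma ReB x y : Re (x - y) = Re x - Re y. Proof. by case: x y => ? ? []. Qed.
Lemma ImB x y : Im (x - y) = Im x - Im y. Proof. by case: x y => ? ? []. Qed.
Lemma ReM x y : Re (x * y) = Re x * Re y - Im x * Im y.
Proof. by case: x y => ? ? []. Qed.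
Lemma ImM x y : Im (x * y) = Re x * Im y + Im x * Re y.
Proof. by case: x y => ? ? []. Qed.
Lemma complexP x y : Re x = Re y -> Im x = Im y -> x = y.
Proof. by case: x y => ? ? [] ? ? /= -> ->. Qed.

Lemma normc_ge0 x : 0 <= normc x.
Proof. by case: x => a b /=; exact: sqrtr_ge0. Qed.

Lemma normc_sqr x : normc x ^+ 2 = Re x ^+ 2 + Im x ^+ 2.
Proof. by case: x => a b /=; rewrite sqr_sqrtr// addr_ge0 ?sqr_ge0. Qed.

Lemma Re_le_normc x : `|Re x| <= normc x.
Proof.
case: x => a b /=; rewrite -sqrtr_sqr ler_wsqrtr//.
by rewrite lerDl sqr_ge0.
Qed.

Lemma Im_le_normc x : `|Im x| <= normc x.
Proof.
case: x => a b /=; rewrite -sqrtr_sqr ler_wsqrtr//.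
by rewrite lerDr sqr_ge0.
Qed.

Lemma normc_le_ReIm x : normc x <= `|Re x| + `|Im x|.
Proof.
rewrite -(@ler_pXn2r _ 2)// ?nnegrE ?normc_ge0 ?addr_ge0//.
rewrite normc_sqr sqrrD !real_normK ?num_real//.
by rewrite lerD2r lerDl mulrn_wge0// mulr_ge0.
Qed.

Lemma normc_real (a : R) : normc a%:C%C = `|a|.
Proof. by rewrite /= expr0n /= addr0 sqrtr_sqr. Qed.

Lemma normc_conj x : normc (conjc x) = normc x.
Proof. by case: x => a b /=; rewrite sqrrN. Qed.

Lemma normc_expi (a : R) : normc (expi a) = 1.
Proof. by rewrite /= cos2Dsin2 sqrtr1. Qed.

Lemma normcX x n : normc (x ^+ n) = normc x ^+ n.
Proof.
by elim: n => [|n ih]; rewrite ?expr0 ?Normc.normc1// !exprS Normc.normcM ih.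
Qed.

Lemma normc_sum (I : Type) (r : seq I) (P : pred I) (F : I -> R[i]) :
  normc (\sum_(i <- r | P i) F i) <= \sum_(i <- r | P i) normc (F i).
Proof.
elim/big_ind2 : _ => [|a b c d ab cd|//]; first by rewrite Normc.normc0.
by apply: le_trans (le_normcD _ _) _; exact: lerD.
Qed.

End complex_numbers.

Section complex_integral.
Context {R : realType} {d : measure_display} {T : measurableType d}.
Variables (mu : {measure set T -> \bar R}) (D : set T).
Hypothesis mD : measurable D.
Implicit Types (f g : T -> R[i]).

Definition cmeasurable g : Prop :=
  measurable_fun D (fun x => Re (g x)) /\ measurable_fun D (fun x => Im (g x)).

(** Bounded measurable functions on [D]: the products of an integrable function
    by one of them are integrable. *)
Definition multiplier g : Prop :=
  cmeasurable g /\ exists M : R, forall x, D x -> normc (g x) <= M.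

Lemma cmeasurableD f g :
  cmeasurable f -> cmeasurable g -> cmeasurable (fun x => f x + g x).
Proof.
move=> [f1 f2] [g1 g2]; split.
- by under eq_fun do rewrite ReD; exact: measurable_funD.
- by under eq_fun do rewrite ImD; exact: measurable_funD.
Qed.

Lemma cmeasurableM f g :
  cmeasurable f -> cmeasurable g -> cmeasurable (fun x => f x * g x).
Proof.
move=> [f1 f2] [g1 g2]; split.
- under eq_fun do rewrite ReM.
  by apply: measurable_funB; exact: measurable_funM.
- under eq_fun do rewrite ImM.
  by apply: measurable_funD; exact: measurable_funM.
Qed.

Lemma multiplier_cst (c : R[i]) : multiplier (fun=> c).
Proof. by split; [split|exists (normc c)]. Qed.

Lemma multiplierD f g :
  multiplier f -> multiplier g -> multiplier (fun x => f x + g x).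
Proof.
move=> [mf [M fM]] [mg [N gN]]; split; first exact: cmeasurableD.
exists (M + N) => x Dx; apply: le_trans (le_normcD _ _) _.
by apply: lerD; [exact: fM|exact: gN].
Qed.

Lemma multiplierM f g :
  multiplier f -> multiplier g -> multiplier (fun x => f x * g x).
Proof.
move=> [mf [M fM]] [mg [N gN]]; split; first exact: cmeasurableM.
exists (M * N) => x Dx; rewrite Normc.normcM.
by apply: ler_pM; rewrite ?normc_ge0//; [exact: fM|exact: gN].
Qed.

Lemma multiplierX f n : multiplier f -> multiplier (fun x => f x ^+ n).
Proof.
move=> mf; elim: n => [|n ih].
  by under eq_fun do rewrite expr0; exact: multiplier_cst.
by under eq_fun do rewrite exprS; exact: multiplierM.
Qed.

Lemma multiplier_conj f : multiplier f -> multiplier (fun x => conjc (f x)).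
Proof.
move=> [[m1 m2] [M fM]]; split.
  split.
  - rewrite (_ : (fun x => _) = fun x => Re (f x))//.
    by apply/funext => x; case: (f x).
  - rewrite (_ : (fun x => _) = fun x => - Im (f x)).
      exact: measurableT_comp.
    by apply/funext => x; case: (f x).
by exists M => x Dx; rewrite normc_conj; exact: fM.
Qed.

Lemma multiplier_real (h : T -> R) : measurable_fun D h ->
  (exists M, forall x, D x -> `|h x| <= M) -> multiplier (fun x => (h x)%:C%C).
Proof.
move=> mh [M hM]; split; first by split.
by exists M => x Dx; rewrite normc_real; exact: hM.
Qed.

Lemma multiplier_expi (h : T -> R) : measurable_fun D h ->
  multiplier (fun x => expi (h x)).
Proof.
move=> mh; split; last by exists 1 => x Dx; rewrite normc_expi.
split => /=.
- apply: (@measurableT_comp _ _ _ _ _ _ (cos : measurableTypeR R -> R)).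
    2: exact: mh.
  exact: (continuous_measurable_fun (@continuous_cos R)).
- apply: (@measurableT_comp _ _ _ _ _ _ (sin : measurableTypeR R -> R)).
    2: exact: mh.
  exact: (continuous_measurable_fun (@continuous_sin R)).
Qed.

Lemma multiplier_sum (I : Type) (r : seq I) (F : I -> T -> R[i]) :
  (forall i, multiplier (F i)) -> multiplier (fun x => \sum_(i <- r) F i x).
Proof.
move=> mF; elim: r => [|i r ih].
  by under eq_fun do rewrite big_nil; exact: multiplier_cst.
by under eq_fun do rewrite big_cons; exact: multiplierD.
Qed.

Let integrableM_bounded (u v : T -> R) : mu.-integrable D (EFin \o u) ->
  measurable_fun D v -> (exists M : R, forall x, D x -> `|v x| <= M) ->
  mu.-integrable D (EFin \o (fun x => u x * v x)).
Proof.
move=> iu mv [M vM].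
apply: (@eq_integrable _ _ _ _ _ mD ((EFin \o u) \* (EFin \o v))%E) => //.
apply: integrableMl => //.
exists M; split; first exact: num_real.
by move=> N MN x Dx; apply: le_trans (vM _ Dx) _; exact: ltW.
Qed.

Lemma cintegrableM f g : cintegrable mu D f -> multiplier g ->
  cintegrable mu D (fun x => f x * g x).
Proof.
move=> [f1 f2] [[m1 m2] [M gM]].
have bRe : exists M : R, forall x, D x -> `|Re (g x)| <= M.
  by exists M => x Dx; apply: le_trans (Re_le_normc _) (gM _ Dx).
have bIm : exists M : R, forall x, D x -> `|Im (g x)| <= M.
  by exists M => x Dx; apply: le_trans (Im_le_normc _) (gM _ Dx).
split.
- under eq_fun do rewrite ReM EFinB.
  by apply: integrableB => //; exact: integrableM_bounded.
- under eq_fun do rewrite ImM EFinD.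
  by apply: integrableD => //; exact: integrableM_bounded.
Qed.

Lemma cintegralD f g : cintegrable mu D f -> cintegrable mu D g ->
  cintegral mu D (fun x => f x + g x) = cintegral mu D f + cintegral mu D g.
Proof.
move=> [f1 f2] [g1 g2]; apply: complexP; rewrite ?ReD ?ImD /=.
- by under eq_Rintegral do rewrite ReD; rewrite RintegralD.
- by under eq_Rintegral do rewrite ImD; rewrite RintegralD.
Qed.

Lemma cintegralZ (c : R[i]) f : cintegrable mu D f ->
  cintegral mu D (fun x => f x * c) = cintegral mu D f * c.
Proof.
move=> [f1 f2]; have H (u : T -> R) (a : R) : mu.-integrable D (EFin \o u) ->
    mu.-integrable D (EFin \o (fun x => u x * a)).
  move=> iu; apply: integrableM_bounded => //.
  by exists `|a|.
apply: complexP; rewrite ?ReM ?ImM /=.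
- under eq_Rintegral do rewrite ReM.
  by rewrite RintegralB ?RintegralZr//; exact: H.
- under eq_Rintegral do rewrite ImM.
  by rewrite RintegralD ?RintegralZr//; exact: H.
Qed.

Lemma eq_cintegral f g : (forall x, D x -> f x = g x) ->
  cintegral mu D f = cintegral mu D g.
Proof.
by move=> fg; congr Complex; apply: eq_Rintegral => x /set_mem Dx; rewrite fg.
Qed.

Lemma cintegral0 : cintegral mu D (fun=> 0) = 0.
Proof.
have -> : 0 = Complex 0 0 :> R[i] by [].
by rewrite /cintegral /= !Rintegral_cst// !mul0r.
Qed.

Lemma cintegral_sum (I : Type) (r : seq I) (F : I -> T -> R[i]) f :
  cintegrable mu D f -> (forall i, multiplier (F i)) ->
  cintegral mu D (fun x => f x * \sum_(i <- r) F i x) =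
  \sum_(i <- r) cintegral mu D (fun x => f x * F i x).
Proof.
move=> fi mF; elim: r => [|i r ih].
  rewrite big_nil -[RHS]cintegral0; apply: eq_cintegral => x _.
  by rewrite big_nil mulr0.
rewrite big_cons -ih -cintegralD; first last.
- by apply: cintegrableM => //; exact: multiplier_sum.
- exact: cintegrableM.
by apply: eq_cintegral => x _; rewrite big_cons mulrDr.
Qed.

Let Rintegral_limit (v_ : nat -> T -> R) (v b : T -> R) :
  (forall n, measurable_fun D (v_ n)) ->
  mu.-integrable D (EFin \o b) ->
  (forall n x, D x -> `|v_ n x| <= b x) ->
  (forall x, D x -> v_ n x @[n --> \oo] --> v x) ->
  \int[mu]_(x in D) v_ n x @[n --> \oo] --> \int[mu]_(x in D) v x.
Proof.
move=> mv ib vb vv.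
have mv' : measurable_fun D v by exact: measurable_fun_cvg mv vv.
have [] := @dominated_convergence _ _ _ mu D mD (fun n => EFin \o v_ n)
  (EFin \o v) (EFin \o b).
- by move=> n; exact/measurable_EFinP.
- exact/measurable_EFinP.
- by apply: aeW => x Dx; apply: cvg_EFin; [exact: nearW|exact: vv].
- by [].
- by apply: aeW => x n Dx; rewrite lee_fin; exact: vb.
- move=> iv _ cv; apply: fine_cvg; rewrite fineK//.
  exact: integrable_fin_num.
Qed.

(** Dominated convergence, in the form in which it is used to pass from a
    sequence of multipliers orthogonal to [f] to their bounded limit. *)
Lemma cintegral_limit0 f g (g_ : nat -> T -> R[i]) (M : R) :
  cintegrable mu D f -> (forall n, cmeasurable (g_ n)) ->
  (forall n x, D x -> normc (g_ n x) <= M) ->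
  (forall x, D x -> normc (g_ n x - g x) @[n --> \oo] --> (0 : R)) ->
  (forall n, cintegral mu D (fun x => f x * g_ n x) = 0) ->
  multiplier g /\ cintegral mu D (fun x => f x * g x) = 0.
Proof.
move=> fi mg gM gg g0.
have cvg_bound (a_ e_ : nat -> R) (a c : R) :
    (forall n, `|a_ n - a| <= c * e_ n) ->
    e_ n @[n --> \oo] --> (0 : R) -> a_ n @[n --> \oo] --> a.
  move=> ae e0; apply/subr_cvg0; apply/norm_cvg0P.
  apply: (@squeeze_cvgr _ _ _ _ (fun=> 0) (fun n => c * e_ n)).
  - by apply: nearW => n; rewrite normr_ge0 ae.
  - exact: cvg_cst.
  - by rewrite -[X in _ --> X](mulr0 c); apply: cvgMr.
have mult_g : multiplier g.
  split; first split.
  - apply: (@measurable_fun_cvg _ _ _ _ (fun n x => Re (g_ n x))).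
      by move=> n; have [] := mg n.
    move=> x Dx.
    apply: (cvg_bound _ (fun n => normc (g_ n x - g x)) _ 1); last exact: gg.
    by move=> n; rewrite mul1r -ReB; exact: Re_le_normc.
  - apply: (@measurable_fun_cvg _ _ _ _ (fun n x => Im (g_ n x))).
      by move=> n; have [] := mg n.
    move=> x Dx.
    apply: (cvg_bound _ (fun n => normc (g_ n x - g x)) _ 1); last exact: gg.
    by move=> n; rewrite mul1r -ImB; exact: Im_le_normc.
  - exists (M + 1) => x Dx.
    have /cvgr0Pnorm_lt/(_ 1 ltr01)[n _ /(_ n (leqnn n))] := gg x Dx.
    rewrite ger0_norm ?normc_ge0// => gn.
    have -> : g x = g_ n x - (g_ n x - g x) by rewrite subKr.
    apply: le_trans (le_normcD _ _) _; rewrite normcN.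
    by apply: lerD; [exact: gM|exact: ltW].
split=> //.
pose b x := (`|Re (f x)| + `|Im (f x)|) * M.
have ib : mu.-integrable D (EFin \o b).
  have [f1 f2] := fi.
  apply: integrableM_bounded; last by exists `|M|.
  - rewrite (_ : _ \o _ =
        ((fun x => `|Re (f x)|%:E) \+ (fun x => `|Im (f x)|%:E))%E).
      apply: integrableD => //; first exact: integrable_norm f1.
      exact: integrable_norm f2.
    by apply/funext => x.
  - exact: measurable_cst.
have normfg n x : D x -> normc (f x * g_ n x) <= b x.
  move=> Dx; rewrite Normc.normcM; apply: ler_pM; rewrite ?normc_ge0//.
    exact: normc_le_ReIm.
  exact: gM.
have mf : cmeasurable f.
  have [/integrableP[f1 _] /integrableP[f2 _]] := fi.
  by split; exact/measurable_EFinP.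
have cvg_fg x n : normc (f x * g_ n x - f x * g x) =
    normc (f x) * normc (g_ n x - g x).
  by rewrite -mulrBr Normc.normcM.
have cRe : \int[mu]_(x in D) Re (f x * g_ n x) @[n --> \oo] -->
    \int[mu]_(x in D) Re (f x * g x).
  apply: (@Rintegral_limit _ _ b) => //.
  - by move=> n; have [] := cmeasurableM mf (mg n).
  - by move=> n x Dx; apply: le_trans (Re_le_normc _) (normfg n x Dx).
  - move=> x Dx; apply: (cvg_bound _ _ _ (normc (f x)) _ (gg x Dx)) => n.
    by rewrite -ReB -cvg_fg; exact: Re_le_normc.
have cIm : \int[mu]_(x in D) Im (f x * g_ n x) @[n --> \oo] -->
    \int[mu]_(x in D) Im (f x * g x).
  apply: (@Rintegral_limit _ _ b) => //.
  - by move=> n; have [] := cmeasurableM mf (mg n).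
  - by move=> n x Dx; apply: le_trans (Im_le_normc _) (normfg n x Dx).
  - move=> x Dx; apply: (cvg_bound _ _ _ (normc (f x)) _ (gg x Dx)) => n.
    by rewrite -ImB -cvg_fg; exact: Im_le_normc.
apply: complexP => /=.
- have fg0 n : \int[mu]_(x in D) Re (f x * g_ n x) = 0 by have [] := g0 n.
  apply: (cvg_unique _ cRe) => //; rewrite (funext fg0); exact: cvg_cst.
- have fg0 n : \int[mu]_(x in D) Im (f x * g_ n x) = 0 by have [] := g0 n.
  apply: (cvg_unique _ cIm) => //; rewrite (funext fg0); exact: cvg_cst.
Qed.

End complex_integral.

(** * Polynomials approximating a step function *)

Section step_polynomials.
Context {R : realType}.
Implicit Types (t u : R) (k n : nat).

Lemma bernoulli_ge u k : u <= 1 -> 1 - k%:R * u <= (1 - u) ^+ k.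
Proof.
move=> u1; elim: k => [|k ih]; first by rewrite mul0r subr0 expr0.
rewrite exprS; apply: le_trans (ler_wpM2l _ ih); last by rewrite subr_ge0.
have : 0 <= k%:R * u ^+ 2 by rewrite mulr_ge0 ?sqr_ge0.
by rewrite -natr1 expr2; lra.
Qed.

(** Both factors are bounded through Bernoulli's inequality: the product is at
    most (1 - u)^k (1 + u)^k = (1 - u^2)^k. *)
Lemma expr_1B_le u k : 0 <= u <= 1 -> (1 - u) ^+ k * (1 + k%:R * u) <= 1.
Proof.
move=> /andP[u0 u1].
have h : 1 + k%:R * u <= (1 + u) ^+ k.
  by have := @bernoulli_ge (- u) k; rewrite mulrN !opprK; apply; lra.
apply: le_trans (ler_wpM2l _ h) _; first by rewrite exprn_ge0// subr_ge0.
rewrite -exprMn; apply: exprn_ile1; nra.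
Qed.

(** On [0, 1] these polynomials converge boundedly to the indicator function of
    [0, 1/2[: the quantity n (2t)^(2n) that governs 1 - (1 - t^(2n))^(n 4^n)
    tends to 0 for t < 1/2, and is at least n for t >= 1/2. *)
Definition step_poly n : {poly R} := (1 - 'X^(2 * n)) ^+ (n * 4 ^ n).

Lemma step_polyE n t : (step_poly n).[t] = (1 - t ^+ (2 * n)) ^+ (n * 4 ^ n).
Proof. by rewrite /step_poly horner_exp !hornerE. Qed.

Lemma step_poly_itv n t : 0 <= t <= 1 -> 0 <= (step_poly n).[t] <= 1.
Proof.
move=> /andP[t0 t1]; have p0 : 0 <= t ^+ (2 * n) by exact: exprn_ge0.
have p1 : t ^+ (2 * n) <= 1 by exact: exprn_ile1.
by rewrite step_polyE exprn_ge0 ?exprn_ile1//; lra.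
Qed.

Let natr_pow4 n t : (n * 4 ^ n)%:R * t ^+ (2 * n) = n%:R * (2 * t) ^+ (2 * n).
Proof.
rewrite natrM natrX -mulrA; congr (_ * _); rewrite !exprM -exprMn.
by congr (_ ^+ _); ring.
Qed.

(** One half of (2t)^(2n) absorbs the factor n, because n (2t)^n (1 - 2t) is
    at most 1. *)
Lemma step_poly_lt n t : 0 <= t < 2^-1 ->
  `|(step_poly n).[t] - 1| <= (2 * t) ^+ n / (1 - 2 * t).
Proof.
move=> /andP[t0 t2]; have /andP[q0 q1] : 0 <= (step_poly n).[t] <= 1.
  by apply: step_poly_itv; lra.
rewrite ler0_norm; last by rewrite subr_le0.
rewrite opprB ler_pdivlMr; last lra.
have p1 : t ^+ (2 * n) <= 1 by apply: exprn_ile1 => //; lra.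
have := bernoulli_ge (n * 4 ^ n) p1; rewrite -step_polyE natr_pow4 => h.
have r01 : 0 <= 1 - 2 * t <= 1 by lra.
have := expr_1B_le n r01; rewrite subKr => h2.
have rn0 : 0 <= (2 * t) ^+ n by apply: exprn_ge0; lra.
have nr : n%:R * (2 * t) ^+ n * (1 - 2 * t) <= 1 by nra.
have -> : (2 * t) ^+ n = (2 * t) ^+ n * 1 by rewrite mulr1.
apply: (@le_trans _ _ ((2 * t) ^+ n * (n%:R * (2 * t) ^+ n * (1 - 2 * t)))).
  rewrite !mulrA ler_pM2r; last lra.
  rewrite -[_ ^+ n * n%:R]mulrC -mulrA -exprD addnn -mul2n; lra.
by rewrite ler_wpM2l.
Qed.

Lemma step_poly_ge n t : 2^-1 <= t <= 1 -> (step_poly n).[t] <= n.+1%:R^-1.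
Proof.
move=> /andP[t2 t1].
have p0 : 0 <= t ^+ (2 * n) by apply: exprn_ge0; lra.
have p1 : t ^+ (2 * n) <= 1 by apply: exprn_ile1 => //; lra.
have /(expr_1B_le (n * 4 ^ n)) : 0 <= t ^+ (2 * n) <= 1 by rewrite p0.
rewrite -step_polyE natr_pow4 => h.
have /andP[q0 q1] : 0 <= (step_poly n).[t] <= 1 by apply: step_poly_itv; lra.
rewrite -[leRHS]mul1r ler_pdivlMr// -nat1r; apply: le_trans h.
rewrite ler_wpM2l// lerD2l ler_peMr//; apply: exprn_ege1; lra.
Qed.

Lemma cvg_step_poly t : 0 <= t <= 1 ->
  `|(step_poly n).[t] - (t < 2^-1)%R%:R| @[n --> \oo] --> (0 : R).
Proof.
move=> /andP[t0 t1]; have [t2|t2] := ltP t 2^-1.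
  apply: (@squeeze_cvgr _ _ _ _ (fun=> 0)
    (fun n => (2 * t) ^+ n / (1 - 2 * t))).
  - by apply: nearW => n; rewrite normr_ge0 step_poly_lt// t0.
  - exact: cvg_cst.
  - rewrite -[X in _ --> X](mul0r (1 - 2 * t)^-1); apply: cvgMl.
    by apply: cvg_expr; rewrite ger0_norm; lra.
apply: (@squeeze_cvgr _ _ _ _ (fun=> 0) (fun n => n.+1%:R^-1)).
- apply: nearW => n; rewrite normr_ge0 subr0 ger0_norm; last first.
    suff /andP[] : 0 <= (step_poly n).[t] <= 1 by [].
    by apply: step_poly_itv; rewrite t0.
  by rewrite step_poly_ge// t2.
- exact: cvg_cst.
- exact: cvg_harmonic.
Qed.

End step_polynomials.

(** * Spaces of functions stable under indicator functions *)

Section multiplier_spaces.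
Context {R : realType} {T : Type}.
Variables (D : set T) (G : set (T -> R[i])).

Definition stable_under (h : T -> R[i]) : Prop :=
  forall g, G g -> G (fun x => h x * g x).

Hypothesis G_add : forall g h, G g -> G h -> G (fun x => g x + h x).
Hypothesis G_scale : forall c, stable_under (fun=> c).
Hypothesis G_bounded :
  forall g, G g -> exists M : R, forall x, D x -> normc (g x) <= M.
Hypothesis G_limit : forall (g_ : nat -> T -> R[i]) (g : T -> R[i]) (M : R),
  (forall n, G (g_ n)) ->
  (forall n x, D x -> normc (g_ n x) <= M) ->
  (forall x, D x -> normc (g_ n x - g x) @[n --> \oo] --> (0 : R)) -> G g.

Lemma stable_under_horner (X : T -> R) (p : {poly R}) :
  stable_under (fun x => (X x)%:C%C) ->
  stable_under (fun x => (p.[X x])%:C%C).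
Proof.
move=> sX; elim/poly_ind: p => [|p c ih] g Gg.
  under eq_fun do rewrite horner0; exact: (@G_scale 0).
rewrite (_ : (fun x => _) =
    fun x => (p.[X x])%:C%C * ((X x)%:C%C * g x) + c%:C%C * g x).
  by apply: G_add; [apply: ih; exact: sX|exact: G_scale].
by apply/funext => x; rewrite !hornerE /= raddfD /= rmorphM mulrDl -mulrA.
Qed.

(** The step polynomials, transplanted by the affine map that sends [a] to 1/2
    and the range of [X] into [0, 1]. *)
Lemma stable_under_ray (X : T -> R) (a : R) :
  (exists K, forall x, D x -> `|X x| <= K) ->
  stable_under (fun x => (X x)%:C%C) ->
  stable_under (fun x => (\1_(X @^-1` `]-oo, a[) x)%:C%C).
Proof.
move=> [K XK] sX g Gg; have [M gM] := G_bounded Gg.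
pose L := 2 * (1 + `|a| + `|K|).
have L0 : 0 < L by rewrite /L mulr_gt0// ltr_pwDl// addr_ge0// ler_wpDl.
pose u : {poly R} := L^-1 *: 'X + (2^-1 - a / L)%:P.
have uE x : u.[X x] = 2^-1 + (X x - a) / L.
  by rewrite /u hornerD hornerZ hornerX hornerC; ring.
have u01 x : D x -> 0 <= u.[X x] <= 1.
  move=> Dx; rewrite uE.
  have XaL : `|X x - a| <= L / 2.
    rewrite /L mulrC mulKf//; have := XK _ Dx; have := ler_norm K.
    by have := ler_normB (X x) a; lra.
  have : `|(X x - a) / L| <= 2^-1.
    by rewrite normrM normfV (gtr0_norm L0) ler_pdivrMr// mulrC.
  by rewrite ler_norml; lra.
have ult x : (u.[X x] < 2^-1) = (X x < a).
  by rewrite uE gtrDl pmulr_llt0 ?invr_gt0// subr_lt0.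
apply: (@G_limit (fun n x => ((step_poly n \Po u).[X x])%:C%C * g x) _ M).
- by move=> n; exact: (stable_under_horner _ sX).
- move=> n x Dx; rewrite Normc.normcM normc_real horner_comp.
  apply: le_trans (gM _ Dx); rewrite ler_piMl ?normc_ge0//.
  by have /andP[q0 q1] := step_poly_itv n (u01 _ Dx); rewrite ger0_norm.
- move=> x Dx; rewrite -[X in _ --> X](mul0r (normc (g x))).
  rewrite [X in X @ _](_ : _ = fun n =>
      `|(step_poly n).[u.[X x]] - (u.[X x] < 2^-1)%R%:R| * normc (g x)).
    by apply: cvgMl; exact: cvg_step_poly (u01 _ Dx).
  apply/funext => n; rewrite -mulrBl -rmorphB Normc.normcM normc_real horner_comp.
  rewrite indicE (_ : (x \in _) = (u.[X x] < 2^-1))// ult.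
  by apply/idP/idP => [/set_mem|Xa]; [|apply/mem_set]; rewrite /= in_itv.
Qed.

Definition stabilizing_sets : set (set T) :=
  [set A | stable_under (fun x => (\1_A x)%:C%C)].

Lemma stabilizing_setsI A B :
  stabilizing_sets A -> stabilizing_sets B -> stabilizing_sets (A `&` B).
Proof.
move=> sA sB g Gg; rewrite (_ : (fun x => _) =
    fun x => (\1_A x)%:C%C * ((\1_B x)%:C%C * g x)); first exact/sA/sB.
by apply/funext => x; rewrite indicI rmorphM mulrA.
Qed.

Lemma stabilizing_setsC A : stabilizing_sets A -> stabilizing_sets (~` A).
Proof.
move=> sA g Gg; rewrite (_ : (fun x => _) =
    fun x => g x + (-1) * ((\1_A x)%:C%C * g x)).
  by apply: G_add => //; apply: G_scale; exact: sA.
apply/funext => x; rewrite !indicE in_setC; case: (x \in A) => /=.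
  by rewrite mul0r mul1r mulN1r subrr.
by rewrite mul0r mul1r mulr0 addr0.
Qed.

(** Indicator functions of intersections are products, so closure under
    intersection is immediate, and countable unions are bounded limits. *)
Lemma sigma_algebra_stabilizing_sets : sigma_algebra setT stabilizing_sets.
Proof.
have s0 : stabilizing_sets set0.
  move=> g Gg; under eq_fun do rewrite indicE in_set0; exact: G_scale.
split => //.
- by move=> A sA; rewrite setTD; exact: stabilizing_setsC.
- move=> F sF.
  pose U n := \big[setU/set0]_(i < n) F i.
  have sU n : stabilizing_sets (U n).
    elim: n => [|n ih]; first by rewrite /U big_ord0.
    rewrite /U big_ord_recr /=.
    rewrite -[X in stabilizing_sets X]setCK setCU; apply: stabilizing_setsC.
    by apply: stabilizing_setsI; exact: stabilizing_setsC.
  move=> g Gg; have [M gM] := G_bounded Gg.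
  apply: (@G_limit (fun n x => (\1_(U n) x)%:C%C * g x) _ M).
  + by move=> n; exact: sU.
  + move=> n x Dx; rewrite Normc.normcM normc_real indicE.
    apply: le_trans (gM _ Dx); rewrite ler_piMl ?normc_ge0//.
    by rewrite normr_nat; case: (_ \in _).
  + move=> x _; apply: cvg_near_cst.
    have [[n _ Fnx]|nF] := pselect ((\bigcup_k F k) x).
      exists n.+1 => //= m /= nm; rewrite !indicE !mem_set ?subrr ?Normc.normc0//.
        by exists n.
      by rewrite /U -bigcup_mkord; exists n.
    apply: nearW => m; rewrite !indicE !memNset ?subrr ?Normc.normc0//.
    by rewrite /U -bigcup_mkord => -[k _ Fk]; apply: nF; exists k.
Qed.

Lemma stabilizing_sets_preimage (d : measure_display) (S : measurableType d)
    (E : set (set S)) (X : T -> S) :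
  @measurable d S = <<s E >> ->
  (forall B, E B -> stabilizing_sets (X @^-1` B)) ->
  forall B, measurable B -> stabilizing_sets (X @^-1` B).
Proof.
move=> mE sE B; rewrite mE => mB.
suff /(_ B mB) : <<s E >> `<=` image_set_system setT X stabilizing_sets.
  by rewrite /image_set_system /= setTI.
apply: smallest_sub.
- exact: sigma_algebra_image sigma_algebra_stabilizing_sets.
- by move=> C EC; rewrite /image_set_system /= setTI; exact: sE.
Qed.

End multiplier_spaces.

(** The Borel sets of R^3 are generated by the half-spaces {x_i < a}, whose
    indicator functions are bounded limits of polynomials in x_i. *)
Lemma stabilizing_sets_R3 (R : realType) (D : set (R * R * R))
    (G : set (R * R * R -> R[i])) :
  (forall g h, G g -> G h -> G (fun x => g x + h x)) ->
  (forall c, stable_under G (fun=> c)) ->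
  (forall g, G g -> exists M : R, forall x, D x -> normc (g x) <= M) ->
  (forall (g_ : nat -> R * R * R -> R[i]) (g : R * R * R -> R[i]) (M : R),
    (forall n, G (g_ n)) ->
    (forall n x, D x -> normc (g_ n x) <= M) ->
    (forall x, D x -> normc (g_ n x - g x) @[n --> \oo] --> (0 : R)) -> G g) ->
  (forall X : R * R * R -> R, 
      [\/ X = fun x => x.1.1, X = fun x => x.1.2 | X = snd] ->
    (exists K, forall x, D x -> `|X x| <= K) /\
    stable_under G (fun x => (X x)%:C%C)) ->
  forall A, measurable A -> stabilizing_sets G A.
Proof.
move=> GD GZ Gb Gl GX.
have sray (X : R * R * R -> R) : (exists K, forall x, D x -> `|X x| <= K) /\
    stable_under G (fun x => (X x)%:C%C) ->
    forall B : set R, measurable B -> stabilizing_sets G (X @^-1` B).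
  move=> [Xb Xs] B mB.
  have := @stabilizing_sets_preimage _ _ _ _ GD GZ Gb Gl _ R (@RGenInftyO.G R) X
    (RGenInftyO.measurableE R) _ B mB.
  by apply=> _ [a ->]; exact: (stable_under_ray GD GZ Gb Gl).
apply: (@stabilizing_sets_preimage _ _ _ _ GD GZ Gb Gl _ _ _ idfun).
  exact: measurable_prod_measurableType.
move=> _ [A mA [B mB <-]].
rewrite (_ : _ @^-1` _ = fst @^-1` A `&` snd @^-1` B)//.
apply: stabilizing_setsI; last first.
  by apply: sray => //; apply: GX; exact: Or33.
move: A mA; apply: (@stabilizing_sets_preimage _ _ _ _ GD GZ Gb Gl).
  exact: measurable_prod_measurableType.
move=> _ [A mA [C mC <-]].
rewrite (_ : _ @^-1` _ =
  (fun x => x.1.1) @^-1` A `&` (fun x => x.1.2) @^-1` C)//.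
by apply: stabilizing_setsI; apply: sray => //; apply: GX;
  [exact: Or31|exact: Or32].
Qed.

(** * Uniqueness for the moment problem on bounded sets *)

Section coordinates.
Context {R : realType}.
Implicit Type x : R * R * R.

Definition horizontal x : R[i] := Complex x.1.1 x.1.2.
Definition vertical x : R[i] := (x.2)%:C%C.

Definition mixed_monomial (a b j : nat) x : R[i] :=
  horizontal x ^+ a * conjc (horizontal x) ^+ b * vertical x ^+ j.

End coordinates.

Section moments.
Context {R : realType}.
Local Notation R3 := (R * R * R)%type.
Variables (mu : {measure set R3 -> \bar R}) (D : set R3).
Hypothesis mD : measurable D.
Hypothesis bD : exists K : R, forall x, D x ->
  [/\ `|x.1.1| <= K, `|x.1.2| <= K & `|x.2| <= K].

Let mx : measurable_fun D (fun x : R3 => x.1.1).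
Proof. by apply: measurable_funTS; apply: measurableT_comp. Qed.

Let my : measurable_fun D (fun x : R3 => x.1.2).
Proof. by apply: measurable_funTS; apply: measurableT_comp. Qed.

Let mz : measurable_fun D (fun x : R3 => x.2).
Proof. by apply: measurable_funTS; exact: measurable_snd. Qed.

Lemma multiplier_horizontal : multiplier D (@horizontal R).
Proof.
have [K DK] := bD; split => //; exists (K + K) => x Dx.
have [xK yK _] := DK x Dx.
by apply: le_trans (normc_le_ReIm _) _; apply: lerD.
Qed.

Lemma multiplier_vertical : multiplier D (@vertical R).
Proof.
have [K DK] := bD; apply: multiplier_real => //.
by exists K => x /DK[].
Qed.

Lemma multiplier_monomial a b j : multiplier D (@mixed_monomial R a b j).
Proof.
apply: multiplierM; last exact/multiplierX/multiplier_vertical.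
apply: multiplierM; apply: multiplierX; first exact: multiplier_horizontal.
exact/multiplier_conj/multiplier_horizontal.
Qed.

(** The multipliers that annihilate [f], together with all their products by
    monomials, form a space closed under bounded limits and stable under the
    coordinates. It contains 1, hence every Borel indicator function. *)
Theorem moment_uniqueness (f : R3 -> R[i]) : cintegrable mu D f ->
  (forall a b j, cintegral mu D (fun x => f x * mixed_monomial a b j x) = 0) ->
  forall A, measurable A -> cintegral mu (D `&` A) f = 0.
Proof.
move=> fi f0 A mA.
pose G := [set g : R3 -> R[i] | multiplier D g /\ forall a b j,
  cintegral mu D (fun x => f x * (g x * mixed_monomial a b j x)) = 0].
have G1 : G (fun=> 1).
  split=> [|a b j]; first exact: multiplier_cst.
  by under eq_fun do rewrite mul1r.
have iG g a b j : G g ->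
    cintegrable mu D (fun x => f x * (g x * mixed_monomial a b j x)).
  move=> [mg _]; apply: cintegrableM => //.
  exact: multiplierM mg (multiplier_monomial _ _ _).
have GD g h : G g -> G h -> G (fun x => g x + h x).
  move=> Gg Gh; split=> [|a b j].
    by apply: multiplierD; [case: Gg|case: Gh].
  under eq_fun do rewrite mulrDl mulrDr.
  rewrite cintegralD//; [|exact: iG|exact: iG].
  by case: Gg => _ ->; case: Gh => _ ->; rewrite addr0.
have GZ c : stable_under G (fun=> c).
  move=> g Gg; split=> [|a b j].
    by apply: multiplierM; [exact: multiplier_cst|case: Gg].
  under eq_fun do rewrite -mulrA mulrCA mulrC.
  by rewrite cintegralZ//; [case: Gg => _ ->; rewrite mul0r|exact: iG].
have Gb g : G g -> exists M : R, forall x, D x -> normc (g x) <= M by case=> -[].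
have Gl (g_ : nat -> R3 -> R[i]) (g : R3 -> R[i]) (M : R) :
    (forall n, G (g_ n)) ->
    (forall n x, D x -> normc (g_ n x) <= M) ->
    (forall x, D x -> normc (g_ n x - g x) @[n --> \oo] --> (0 : R)) -> G g.
  move=> Gg gM gg.
  have H a b j : multiplier D g /\
      cintegral mu D (fun x => (f x * mixed_monomial a b j x) * g x) = 0.
    apply: (@cintegral_limit0 _ _ _ mu _ mD _ g g_ M) => //.
    - by apply: cintegrableM => //; exact: multiplier_monomial.
    - by move=> n; have [[]] := Gg n.
    - move=> n; have [_ /(_ a b j)] := Gg n.
      by under eq_fun do rewrite mulrCA mulrC.
  split; first by have [] := H 0 0 0.
  move=> a b j; have [_] := H a b j.
  by under eq_fun do rewrite mulrAC -mulrA.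
have GW : stable_under G (@horizontal R).
  move=> g Gg; split=> [|a b j].
    by apply: multiplierM; [exact: multiplier_horizontal|case: Gg].
  have [_ /(_ a.+1 b j) <-] := Gg; apply: eq_cintegral => x _.
  by rewrite /mixed_monomial exprS; ring.
have GC : stable_under G (fun x => conjc (horizontal x)).
  move=> g Gg; split=> [|a b j].
    apply: multiplierM; last by case: Gg.
    exact/multiplier_conj/multiplier_horizontal.
  have [_ /(_ a b.+1 j) <-] := Gg; apply: eq_cintegral => x _.
  by rewrite /mixed_monomial exprS; ring.
have GV : stable_under G (@vertical R).
  move=> g Gg; split=> [|a b j].
    by apply: multiplierM; [exact: multiplier_vertical|case: Gg].
  have [_ /(_ a b j.+1) <-] := Gg; apply: eq_cintegral => x _.
  by rewrite /mixed_monomial exprS; ring.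
have GX (X : R3 -> R) :
    [\/ X = fun x => x.1.1, X = fun x => x.1.2 | X = snd] ->
    (exists K, forall x, D x -> `|X x| <= K) /\
    stable_under G (fun x => (X x)%:C%C).
  have [K DK] := bD; case=> ->; split; try by exists K => x /DK[].
  - move=> g Gg; rewrite (_ : (fun x => _) = fun x => (2^-1)%:C%C *
        (horizontal x * g x + conjc (horizontal x) * g x)).
      by apply: GZ; apply: GD; [exact: GW|exact: GC].
    apply/funext => x; rewrite -mulrDl mulrA; congr (_ * _).
    by apply: complexP; rewrite ?ReM ?ImM ?ReD ?ImD /=; lra.
  - move=> g Gg; rewrite (_ : (fun x => _) = fun x => (Complex 0 (- 2^-1)) *
        (horizontal x * g x + (-1) * (conjc (horizontal x) * g x))).
      by apply: (GZ _); apply: GD; [exact: GW|apply: GZ; exact: GC].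
    apply/funext => x; rewrite mulN1r -mulrBl mulrA; congr (_ * _).
    by apply: complexP; rewrite ?ReM ?ImM ?ReB ?ImB /=; lra.
  - exact: GV.
have [_ /(_ 0 0 0)] := stabilizing_sets_R3 GD GZ Gb Gl GX mA G1.
have Dfx (x : R3) : (D x -> f x * ((\1_A x)%:C%C * 1 * mixed_monomial 0 0 0 x) =
    if x \in A then f x else 0).
  rewrite /mixed_monomial !expr0 !mulr1 indicE.
  by case: (x \in A); rewrite ?mulr1 ?mulr0.
rewrite (eq_cintegral _ Dfx) => <-.
rewrite /cintegral !Rintegral_mkcondr.
by congr Complex; apply: eq_Rintegral => x _; rewrite !patchE; case: (x \in A).
Qed.

End moments.

(** * Taylor expansion of the exponential on the imaginary axis *)

Section exponential.
Context {R : realType}.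
Implicit Types (x y : R) (n : nat).

Lemma expi0 : expi 0 = 1 :> R[i].
Proof. by rewrite /expi cos0 sin0. Qed.

Lemma expiD x y : expi (x + y) = expi x * expi y.
Proof. by apply: complexP; rewrite ?ReM ?ImM /= ?cosD ?sinD //; ring. Qed.

Lemma expiM_natl n x : expi (n%:R * x) = expi x ^+ n.
Proof.
elim: n => [|n ih]; first by rewrite mul0r expi0.
by rewrite -natr1 mulrDl mul1r expiD ih exprSr.
Qed.

Lemma expi_2pi : expi (2 * pi) = 1 :> R[i].
Proof. by rewrite /expi mulr_natl cos2pi sin2pi. Qed.

Lemma expi_neq1 x : 0 < x < 2 * pi -> expi x != 1.
Proof.
move=> /andP[x0 x2pi]; apply/eqP => -[cx1 _].
have : 0 < sin (x / 2) by apply: sin_gt0_pi; lra.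
have := cosD (x / 2) (x / 2); rewrite -splitr cx1.
have := cos2Dsin2 (x / 2); nra.
Qed.

(** The Taylor polynomials of cos and sin are the real and imaginary parts of
    that of expi, so that either one is, up to sign, the derivative of the next
    of the other. *)
Definition taylor_cos n : {poly R} :=
  \poly_(a < n) (Re (Complex 0 1 ^+ a : R[i]) / a`!%:R).
Definition taylor_sin n : {poly R} :=
  \poly_(a < n) (Im (Complex 0 1 ^+ a : R[i]) / a`!%:R).

Let fact_cancel (c : R) n : c / n.+1`!%:R *+ n.+1 = c / n`!%:R.
Proof.
rewrite factS natrM -mulr_natr; field.
by rewrite pnatr_eq0 -lt0n fact_gt0 addrC natr1 pnatr_eq0.
Qed.

Lemma deriv_taylor_cos n : (taylor_cos n.+1)^`() = - taylor_sin n.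
Proof.
apply/polyP => a; rewrite coefN coef_deriv !coef_poly ltnS.
case: ltnP => _; last by rewrite mul0rn oppr0.
by rewrite fact_cancel exprS ReM /= mul0r mul1r sub0r mulNr.
Qed.

Lemma deriv_taylor_sin n : (taylor_sin n.+1)^`() = taylor_cos n.
Proof.
apply/polyP => a; rewrite coef_deriv !coef_poly ltnS.
case: ltnP => _; last by rewrite mul0rn.
by rewrite fact_cancel exprS ImM /= mul0r mul1r add0r.
Qed.

(* Mean value theorem on either side of 0. *)
Let MVT_power (F F' : R -> R) n : F 0 = 0 ->
  (forall x : R, is_derive x (1 : R) F (F' x)) ->
  (forall x, `|F' x| <= `|x| ^+ n) -> forall y, `|F y| <= `|y| ^+ n.+1.
Proof.
move=> F0 dF bF y.
have cF A : {within A, continuous F}.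
  apply: continuous_subspaceT => x; apply: differentiable_continuous.
  by apply/derivable1_diffP; have [] := dF x.
have [y0|y0] := leP 0 y.
  have [c] := MVT_segment y0 (fun x _ => dF x) (cF _).
  rewrite in_itv /= F0 subr0 => /andP[c0 cy] ->.
  rewrite subr0 normrM exprSr ler_wpM2r//; apply: le_trans (bF c) _.
  by rewrite lerXn2r ?nnegrE// !ger0_norm.
have [c] := MVT_segment (ltW y0) (fun x _ => dF x) (cF _).
rewrite in_itv /= F0 sub0r sub0r => /andP[cy c0] /(congr1 Num.norm).
rewrite normrN => ->; rewrite normrM normrN exprSr ler_wpM2r//.
apply: le_trans (bF c) _.
by rewrite lerXn2r ?nnegrE// !ler0_norm ?lerN2// ltW.
Qed.

Let is_derive_horner (p : {poly R}) (x : R) :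
  is_derive x (1 : R) (horner p) (p^`()).[x].
Proof.
apply: DeriveDef; first exact: derivable_horner.
by rewrite derivE derive1E.
Qed.

(** Each derivative lowers the order of the remainder by one, and both
    remainders vanish at 0, so the bound follows by induction from the mean
    value theorem. *)
Lemma taylor_cos_sin n : forall y,
  `|cos y - (taylor_cos n).[y]| <= `|y| ^+ n /\
  `|sin y - (taylor_sin n).[y]| <= `|y| ^+ n.
Proof.
have C0 m : (taylor_cos m.+1).[0] = 1.
  by rewrite horner_coef0 coef_poly /= divr1.
have S0 m : (taylor_sin m.+1).[0] = 0.
  by rewrite horner_coef0 coef_poly /= mul0r.
elim: n => [|n ih] y.
  rewrite /taylor_cos /taylor_sin !poly_def !big_ord0 !horner0 !subr0 expr0.
  by rewrite !ler_norml cos_geN1 cos_le1 sin_geN1 sin_le1.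
split.
- apply: (@MVT_power (fun x => cos x - (taylor_cos n.+1).[x])
      (fun x => - (sin x - (taylor_sin n).[x]))) => [|x|x].
  + by rewrite cos0 C0 subrr.
  + have := is_deriveB (is_derive_cos x) (is_derive_horner (taylor_cos n.+1) x).
    by rewrite deriv_taylor_cos hornerN (opprD (sin x)).
  + by rewrite normrN; have [] := ih x.
- apply: (@MVT_power (fun x => sin x - (taylor_sin n.+1).[x])
      (fun x => cos x - (taylor_cos n).[x])) => [|x|x].
  + by rewrite sin0 S0 subrr.
  + have := is_deriveB (is_derive_sin x) (is_derive_horner (taylor_sin n.+1) x).
    by rewrite deriv_taylor_sin.
  + by have [] := ih x.
Qed.

Lemma expi_taylor n y :
  normc (expi y - \sum_(a < n) (Complex 0 1 * y%:C%C) ^+ a / a`!%:R) <=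
  2 * `|y| ^+ n.
Proof.
have term a : (Complex 0 1 * y%:C%C) ^+ a / a`!%:R =
    Complex 0 1 ^+ a * (y ^+ a / a`!%:R)%:C%C :> R[i].
  by rewrite exprMn rmorphM /= rmorphXn fmorphV rmorph_nat mulrA.
have [hc hs] := taylor_cos_sin n y.
apply: le_trans (normc_le_ReIm _) _; rewrite mulr_natl mulr2n; apply: lerD.
- apply: le_trans hc; rewrite ReB /= (big_morph _ ReD (erefl _)) horner_poly.
  under eq_bigr do rewrite term ReM /= mulr0 subr0 mulrA mulrAC.
  exact: lexx.
- apply: le_trans hs; rewrite ImB /= (big_morph _ ImD (erefl _)) horner_poly.
  under eq_bigr do rewrite term ImM /= mulr0 add0r mulrA mulrAC.
  exact: lexx.
Qed.

End exponential.

(** * Averages over roots of unity *)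

Section circle_average.
Context {R : realType}.
Implicit Types (w u : R[i]) (r : R) (n a m j : nat).

Definition unit_root (N j : nat) : R[i] := expi (2 * pi / N%:R) ^+ j.

Lemma normc_unit_root N j : normc (unit_root N j) = 1.
Proof. by rewrite normcX normc_expi expr1n. Qed.

Lemma unit_root_conj N j : unit_root N j * conjc (unit_root N j) = 1.
Proof.
have := normc_sqr (unit_root N j); rewrite normc_unit_root expr1n.
case: (unit_root N j) => a b /= ab.
by apply: complexP; rewrite ?ReM ?ImM /=; [rewrite ab|]; ring.
Qed.

Lemma sum_unit_root N m : (m < N)%N ->
  \sum_(j < N) unit_root N j ^+ m = if m == 0 then N%:R else 0.
Proof.
move=> mN; have [->|m0] := eqVneq m 0.
  by under eq_bigr do rewrite expr0; rewrite sumr_const card_ord.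
pose z : R[i] := expi (2 * pi / N%:R) ^+ m.
have N0 : 0 < N%:R :> R by rewrite ltr0n (leq_ltn_trans _ mN).
have z1 : z != 1.
  rewrite /z -expiM_natl; apply: expi_neq1.
  have m0' : 0 < m%:R :> R by rewrite ltr0n lt0n.
  have p0 := pi_gt0 R.
  rewrite mulr_gt0//=; last by rewrite divr_gt0// mulr_gt0.
  rewrite mulrCA gtr_pMr ?mulr_gt0// ltr_pdivrMr// mul1r ltr_nat//.
have zN : z ^+ N = 1.
  rewrite /z -exprM mulnC exprM -expiM_natl mulrC divfK ?gt_eqF//.
  by rewrite expi_2pi expr1n.
have := subrX1 z N; rewrite zN subrr => /esym/eqP.
rewrite mulf_eq0 subr_eq0 (negPf z1) /= => /eqP sz.
rewrite -[RHS]sz; apply: eq_bigr => j _.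
by rewrite /unit_root /z -!exprM mulnC.
Qed.

Let ReE w : (Re w)%:C%C = 2^-1 * (w + conjc w).
Proof.
have -> : 2^-1 = (2^-1)%:C%C :> R[i] by rewrite fmorphV rmorph_nat.
by case: w => a b; apply: complexP; rewrite ?ReM ?ImM ?ReD ?ImD /=; lra.
Qed.

(** Expanding the power of Re (w / u) = (w / u + conj w * u) / 2 by the binomial
    formula, the average over u kills every term but u^(-n), which occurs only
    when the exponent is n. *)
Lemma circle_average w n a N : (a <= n)%N -> (2 * n < N)%N ->
  \sum_(j < N) unit_root N j ^+ n * (Re (w * conjc (unit_root N j)))%:C%C ^+ a =
  if a == n then N%:R * (w / 2) ^+ n else 0.
Proof.
move=> an nN.
have termE j : unit_root N j ^+ n *
    (Re (w * conjc (unit_root N j)))%:C%C ^+ a =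
    \sum_(b < a.+1) 2^-1 ^+ a * (w ^+ (a - b) * conjc w ^+ b *+ 'C(a, b)) *
      unit_root N j ^+ (n - a + 2 * b).
  set u := unit_root N j; have uu : u * conjc u = 1 := unit_root_conj N j.
  rewrite ReE rmorphM /= conjcK exprMn exprDn mulr_sumr mulr_sumr.
  apply: eq_bigr => -[b /= ba] _; rewrite ltnS in ba.
  have -> : u ^+ n = u ^+ (n - a) * u ^+ (a - b) * u ^+ b.
    by rewrite -!exprD; congr (_ ^+ _); lia.
  rewrite !exprMn mul2n -addnn !exprD.
  have uab : u ^+ (a - b) * conjc u ^+ (a - b) = 1 by rewrite -exprMn uu expr1n.
  transitivity ((u ^+ (a - b) * conjc u ^+ (a - b)) * (2^-1 ^+ a *
    (w ^+ (a - b) * conjc w ^+ b *+ 'C(a, b)) * (u ^+ (n - a) * (u ^+ b * u ^+ b)))).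
    have [c natE] : exists c : R[i], forall t, t *+ 'C(a, b) = t * c.
      by exists 'C(a, b)%:R => t; rewrite mulr_natr.
    by rewrite !natE; ring.
  by rewrite uab mul1r.
under eq_bigr do rewrite termE.
rewrite exchange_big /=; under eq_bigr do rewrite -mulr_sumr.
have sumE (b : 'I_a.+1) : \sum_(j < N) unit_root N j ^+ (n - a + 2 * b) =
    if (n - a + 2 * b == 0)%N then N%:R else 0.
  by apply: sum_unit_root; have := ltn_ord b; lia.
under eq_bigr do rewrite sumE.
rewrite big_ord_recl /= bin0 mulr1n subn0 expr0 mulr1 big1 ?addr0; last first.
  by move=> b _; rewrite /bump /= addn_eq0 mulnDr /= andbF mulr0.
rewrite muln0 addn0 subn_eq0; have [->|na] := eqVneq a n.
  by rewrite leqnn -exprMn mulrC [2^-1 * _]mulrC.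
by rewrite leqNgt ltn_neqAle na an mulr0.
Qed.

(** The average over the circle of radius [r], normalized so that it extracts
    the n-th power of [w] as [r] tends to 0. *)
Definition average_kernel n r w : R[i] :=
  (* the exponents met in the average lie between 0 and 2 n *)
  let N := (2 * n).+1 in
  n`!%:R * 2 ^+ n / ((- Complex 0 1) * r%:C%C) ^+ n / N%:R *
  \sum_(j < N) unit_root N j ^+ n *
    expi (- (r * Re (w * conjc (unit_root N j)))).

(** Taylor expansion to order n: the terms of order below n average to 0, that
    of order n gives w^n, and the remainder is O(r). *)
Lemma average_kernel_cvg n r w : 0 < r -> normc w <= 1 ->
  normc (average_kernel n r w - w ^+ n) <= n`!%:R * 2 ^+ n.+1 * r.
Proof.
move=> r0 w1; pose N := (2 * n).+1.
pose y j := - (r * Re (w * conjc (unit_root N j))).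
pose ir : R[i] := - Complex 0 1 * r%:C%C.
have yr j : `|y j| <= r.
  rewrite normrN normrM gtr0_norm//; apply: ler_piMr; first exact: ltW.
  apply: le_trans (Re_le_normc _) _.
  by rewrite Normc.normcM normc_conj normc_unit_root mulr1.
pose rem j := expi (y j) -
  \sum_(a < n.+1) (Complex 0 1 * (y j)%:C%C) ^+ a / a`!%:R.
have remE j : normc (rem j) <= 2 * r ^+ n.+1.
  apply: le_trans (expi_taylor _ _) _; rewrite ler_wpM2l//.
  by rewrite lerXn2r ?nnegrE// ltW.
have iy j : Complex 0 1 * (y j)%:C%C = ir * (Re (w * conjc (unit_root N j)))%:C%C.
  rewrite /ir /y rmorphN rmorphM /=; ring.
have main : \sum_(j < N) unit_root N j ^+ n *
    \sum_(a < n.+1) (Complex 0 1 * (y j)%:C%C) ^+ a / a`!%:R =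
    N%:R * (ir * (w / 2)) ^+ n / n`!%:R.
  under eq_bigr do rewrite mulr_sumr.
  rewrite exchange_big /=.
  transitivity (\sum_(a < n.+1) ir ^+ a / a`!%:R *
      (if a == n :> nat then N%:R * (w / 2) ^+ n else 0)).
    apply: eq_bigr => a _.
    rewrite -(@circle_average w n a N); [|by rewrite -ltnS|by []].
    rewrite mulr_sumr; apply: eq_bigr => j _.
    by rewrite iy [(ir * _) ^+ a]exprMn; ring.
  rewrite big_ord_recr /= eqxx big1 ?add0r; last first.
    by move=> a _; rewrite ltn_eqF ?ltn_ord// mulr0.
  by rewrite [(ir * _) ^+ n]exprMn; ring.
have ir0 : ir != 0.
  rewrite /ir mulf_neq0// ?oppr_eq0.
    by rewrite eq_complex /= oner_eq0 andbF.
  by rewrite eq_complex /= gt_eqF.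
have f0 : n`!%:R != 0 :> R[i] by rewrite pnatr_eq0 -lt0n fact_gt0.
have N0 : N%:R != 0 :> R[i] by rewrite pnatr_eq0.
have t0 : 2 != 0 :> R[i] by rewrite pnatr_eq0.
have normN (k : nat) : normc (k%:R : R[i]) = k%:R.
  by rewrite -(rmorph_nat (real_complex R)) normc_real normr_nat.
have nir : normc ir = r.
  rewrite Normc.normcM normcN normc_real gtr0_norm//=.
  by rewrite expr0n expr1n add0r sqrtr1 mul1r.
rewrite /average_kernel -/N -/ir.
have -> : \sum_(j < N) unit_root N j ^+ n *
      expi (- (r * Re (w * conjc (unit_root N j)))) =
    N%:R * (ir * (w / 2)) ^+ n / n`!%:R + \sum_(j < N) unit_root N j ^+ n * rem j.
  rewrite -main -big_split /=; apply: eq_bigr => j _.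
  by rewrite -mulrDr /rem addrC subrK.
rewrite mulrDr; clearbody ir.
have -> : n`!%:R * 2 ^+ n / ir ^+ n / N%:R *
    (N%:R * (ir * (w / 2)) ^+ n / n`!%:R) = w ^+ n.
  rewrite !exprMn exprVn.
  have irn : ir ^+ n != 0 by rewrite expf_neq0.
  have tn : 2 ^+ n != 0 :> R[i] by rewrite expf_neq0.
  move: irn tn; move: (ir ^+ n) (2 ^+ n) => p q p0 q0.
  by field; rewrite f0 q0 N0 p0.
rewrite addrAC subrr add0r Normc.normcM.
have sumle : normc (\sum_(j < N) unit_root N j ^+ n * rem j) <=
    N%:R * (2 * r ^+ n.+1).
  apply: le_trans (normc_sum _ _ _) _.
  rewrite mulr_natl -[in leRHS](card_ord N) -sumr_const.
  apply: ler_sum => j _.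
  by rewrite Normc.normcM normcX normc_unit_root expr1n mul1r.
rewrite !Normc.normcM !Normc.normcV !normcX !normN nir.
apply: le_trans (ler_wpM2l _ sumle) _.
  by rewrite !mulr_ge0 ?invr_ge0 ?exprn_ge0// ltW.
rewrite le_eqVlt; apply/orP; left; apply/eqP.
have N0' : N%:R != 0 :> R by rewrite pnatr_eq0.
have rn : r ^+ n != 0 by rewrite expf_neq0// gt_eqF.
rewrite !exprS; move: rn; move: (r ^+ n) => p p0.
by field; rewrite N0' p0.
Qed.

End circle_average.

(** * The leading coefficient on a small circle *)

Section leading_coefficient.
Context {R : realType} {d : measure_display} {T : measurableType d}.
Variables (mu : {measure set T -> \bar R}) (D : set T).
Hypothesis mD : measurable D.
Variables (f w : T -> R[i]) (v : T -> R).
Hypothesis fi : cintegrable mu D f.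
Hypothesis mw : multiplier D w.
Hypothesis w1 : forall x, D x -> normc (w x) <= 1.
Hypothesis mv : measurable_fun D v.
Hypothesis v1 : forall x, D x -> `|v x| <= 1.

(** Along the curve of phases r Re (w / u) + r^2 v, the n-th Fourier coefficient
    in u is c_n r^n times the integral of f w^n, up to O(r^(n+1)): since v enters
    with the factor r^2 only and does not depend on u, it does not contribute to
    the leading term. *)
Lemma vanishing_power_moment n :
  (forall r (u : R[i]), normc u = 1 -> cintegral mu D (fun x =>
    expi (- (r * Re (w x * conjc u) + r ^+ 2 * v x)) * f x) = 0) ->
  cintegral mu D (fun x => f x * w x ^+ n) = 0.
Proof.
move=> f0.
pose phase (r : R) (u : R[i]) x : R := r * Re (w x * conjc u) + r ^+ 2 * v x.
have mphase r u : multiplier D (fun x => expi (- phase r u x)).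
  apply: multiplier_expi; apply: measurableT_comp => //.
  apply: measurable_funD; apply: measurable_funM => //.
  by have [[]] := multiplierM mw (multiplier_cst D (conjc u)).
pose r_ (k : nat) : R := k.+1%:R^-1.
have r0 k : 0 < r_ k by rewrite invr_gt0.
have r1 k : r_ k <= 1 by rewrite invf_le1// ler1n.
pose N := (2 * n).+1.
pose c r : R[i] := n`!%:R * 2 ^+ n / (- Complex 0 1 * r%:C%C) ^+ n / N%:R.
pose g_ k x := expi (- (r_ k ^+ 2 * v x)) * average_kernel n (r_ k) (w x).
have gE k x : g_ k x = \sum_(j < N)
    expi (- phase (r_ k) (unit_root N j) x) * (c (r_ k) * unit_root N j ^+ n).
  rewrite /g_ /average_kernel -/N -/(c _) !mulr_sumr; apply: eq_bigr => j _.
  rewrite /phase opprD expiD; ring.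
have mg k : multiplier D (g_ k).
  rewrite (funext (gE k)); apply: multiplier_sum => j.
  by apply: multiplierM; [exact: mphase|exact: multiplier_cst].
pose C : R := n`!%:R * 2 ^+ n.+1 + 2.
have C0 : 0 <= C by rewrite addr_ge0// mulr_ge0// exprn_ge0.
have gw k x : D x -> normc (g_ k x - w x ^+ n) <= C * r_ k.
  move=> Dx; rewrite (_ : g_ k x - w x ^+ n =
    expi (- (r_ k ^+ 2 * v x)) * (average_kernel n (r_ k) (w x) - w x ^+ n) +
    (expi (- (r_ k ^+ 2 * v x)) - 1) * w x ^+ n); last by rewrite /g_; ring.
  apply: le_trans (le_normcD _ _) _; rewrite !Normc.normcM normc_expi mul1r.
  rewrite mulrDl; apply: lerD; first by apply: average_kernel_cvg => //; exact: w1.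
  have e1 : normc (expi (- (r_ k ^+ 2 * v x)) - 1) <= 2 * r_ k.
    have := expi_taylor 1 (- (r_ k ^+ 2 * v x)).
    rewrite big_ord1 expr0 expr1 divr1 => /le_trans; apply.
    rewrite ler_wpM2l// normrN normrM ger0_norm ?sqr_ge0// expr2.
    have := v1 Dx; have := r0 k; have := r1 k; have := normr_ge0 (v x); nra.
  apply: le_trans e1; apply: ler_piMr; first exact: normc_ge0.
  by rewrite normcX exprn_ile1 ?normc_ge0// w1.
have [] // := @cintegral_limit0 _ _ _ mu _ mD f (fun x => w x ^+ n) g_ (C + 1).
- by move=> k; have [] := mg k.
- move=> k x Dx; rewrite -[g_ k x](subrK (w x ^+ n)).
  apply: le_trans (le_normcD _ _) _; apply: lerD.
    by apply: le_trans (gw k x Dx) _; exact: ler_piMr.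
  by rewrite normcX exprn_ile1 ?normc_ge0// w1.
- move=> x Dx; apply: (@squeeze_cvgr _ _ _ _ (fun=> 0) (fun k => C * r_ k)).
  + by apply: nearW => k; rewrite normc_ge0 gw.
  + exact: cvg_cst.
  + by rewrite -[X in _ --> X](mulr0 C); apply: cvgMr; exact: cvg_harmonic.
- move=> k; under eq_fun do rewrite gE.
  rewrite cintegral_sum//; last first.
    by move=> j; apply: multiplierM; [exact: mphase|exact: multiplier_cst].
  rewrite big1// => j _; under eq_fun do rewrite mulrA.
  rewrite cintegralZ//; last exact: cintegrableM.
  under eq_fun do rewrite mulrC.
  by rewrite f0 ?mul0r// normc_unit_root.
Qed.

End leading_coefficient.

(** * Integrals over the sphere *)

Section sphere_integrals.
Context {R : realType}.
Local Notation R2 := (measurableTypeR R * measurableTypeR R)%type.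
Local Notation R3 := (R * R * R)%type.

Lemma measurable_sphere : measurable (@sphere R).
Proof.
have mdot : measurable_fun setT (fun x : R3 => dot3 x x).
  have m1 : measurable_fun setT (fun x : R3 => x.1.1).
    exact: measurableT_comp measurable_fst measurable_fst.
  have m2 : measurable_fun setT (fun x : R3 => x.1.2).
    exact: measurableT_comp measurable_snd measurable_fst.
  by apply: measurable_funD; [apply: measurable_funD|]; apply: measurable_funM.
by have := mdot measurableT [set 1] (measurable_set1 1); rewrite setTI.
Qed.

Lemma sphere_coord_le1 (x : R3) : sphere x ->
  [/\ `|x.1.1| <= 1, `|x.1.2| <= 1 & `|x.2| <= 1].
Proof.
rewrite /sphere /dot3 /= => x1; rewrite !ler_norml.
by split; apply/andP; split; nra.
Qed.

Lemma sphere_bounded : exists K : R, forall x : R3, sphere x ->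
  [/\ `|x.1.1| <= K, `|x.1.2| <= K & `|x.2| <= K].
Proof. by exists 1 => x; exact: sphere_coord_le1. Qed.

Lemma normc_horizontal_le1 (x : R3) : sphere x -> normc (horizontal x) <= 1.
Proof.
rewrite /sphere /dot3 /= => x1.
rewrite -sqrtr1 ler_wsqrtr//; nra.
Qed.

Lemma horizontal_conj (x : R3) : sphere x ->
  horizontal x * conjc (horizontal x) = 1 - vertical x ^+ 2.
Proof.
rewrite /sphere /dot3 /= => x1.
by apply: complexP; rewrite ?ReM ?ImM ?ReB ?ImB expr2 ?ReM ?ImM /=; nra.
Qed.

Lemma sphere_polar (t : R2) : sphere (polar t).
Proof.
rewrite /sphere /dot3 /polar /=.
have := cos2Dsin2 t.1; have := cos2Dsin2 t.2.
rewrite !expr2 => h1 h2; nra.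
Qed.

Let polar_measure_dom (u : R2 -> R) :
  (@polar_measure R).-integrable setT (EFin \o u) ->
  (\int[@polar_measure R]_(t in setT) (u t)%:E =
   \int[@polar_measure R]_(t in polar_dom) (u t)%:E)%E.
Proof.
move=> iu; rewrite (@negligible_integral _ _ _ _ setT (~` polar_dom)) //.
- by rewrite setTD setCK.
- by apply: measurableC; exact: measurable_polar_dom.
- by rewrite /= /polar_measure setICl integral_set0.
Qed.

Let Rintegral_sphere (u : R3 -> R) :
  (@sphere_measure R).-integrable sphere (EFin \o u) ->
  \int[@sphere_measure R]_(x in sphere) u x =
  \int[@polar_measure R]_(t in polar_dom) u (polar t).
Proof.
move=> iu; pose u' : R3 -> \bar R := (EFin \o u) \_ sphere.
have mS := measurable_sphere.
have mu' : measurable_fun setT u'.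
  by apply/(measurable_restrictT _ mS); have /integrableP[] := iu.
have polS : polar @^-1` (@sphere R) = setT.
  by apply/seteqP; split=> t // _; exact: sphere_polar.
have u'E x : sphere x -> u' x = (u x)%:E.
  by move=> Sx; rewrite /u' patchE mem_set.
have iup : (@polar_measure R).-integrable (polar @^-1` (@sphere R)) (u' \o polar).
  rewrite polS; apply/integrableP; split.
    by apply: measurableT_comp => //; exact: measurable_polar.
  case/integrableP: iu => _; apply: le_lt_trans.
  rewrite -polS.
  have mabs : measurable_fun sphere (fun x => `|u' x|%E).
    by apply: measurable_funTS; exact: measurableT_comp.
  have abs0 : {in sphere, forall x, (0 <= `|u' x|)%E}.
    by move=> x _; exact: abse_ge0.
  rewrite -(ge0_integral_pushforward (@measurable_polar R)
    (@polar_measure R) mS mabs abs0).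
  rewrite le_eqVlt; apply/orP; left; apply/eqP.
  transitivity (\int[@sphere_measure R]_(x in sphere) `|u' x|)%E => //.
  by apply: eq_integral => x /set_mem Sx; rewrite u'E.
rewrite /Rintegral; congr fine.
transitivity (\int[@sphere_measure R]_(x in sphere) u' x)%E.
  by apply: eq_integral => x /set_mem Sx; rewrite u'E.
rewrite (_ : (@sphere_measure R : set R3 -> \bar R) =
  pushforward (@polar_measure R) polar)//.
rewrite (integral_pushforward (@measurable_polar R) mu' iup mS) polS.
have u'polE t : u' (polar t) = (u (polar t))%:E.
  by rewrite u'E//; exact: sphere_polar.
rewrite -polar_measure_dom; first by apply: eq_integral => t _; exact: u'polE.
by move: iup; rewrite polS; apply: eq_integrable => // t _; exact: u'polE.
Qed.

Lemma cintegral_sphere (F : R3 -> R[i]) :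
  cintegrable (@sphere_measure R) sphere F ->
  cintegral (@sphere_measure R) sphere F =
  cintegral (@polar_measure R) polar_dom (fun t => F (polar t)).
Proof. by move=> [F1 F2]; congr Complex; exact: Rintegral_sphere. Qed.

(** Both the powers of x + iy and those of its conjugate are leading
    coefficients, since the two horizontal vectors (Re u, Im u) and
    (Re u, - Im u) are lifted to the same height r^2 on the paraboloid. *)
Lemma paraboloid_power_moments (f : R3 -> R[i]) (n : nat) : @L1_sphere R f ->
  (forall xi, paraboloid xi -> fourier_sphere f xi = 0) ->
  cintegral (@sphere_measure R) sphere (fun x => f x * horizontal x ^+ n) = 0 /\
  cintegral (@sphere_measure R) sphere
    (fun x => f x * conjc (horizontal x) ^+ n) = 0.
Proof.
move=> fi f0; have mS := measurable_sphere.
have mh := multiplier_horizontal sphere_bounded.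
have mz : measurable_fun (@sphere R) (fun x : R3 => x.2).
  by apply: measurable_funTS; exact: measurable_snd.
have z1 (x : R3) : sphere x -> `|x.2| <= 1 by case/sphere_coord_le1.
split; apply: (vanishing_power_moment mS fi _ _ mz z1) => //.
- exact: normc_horizontal_le1.
- move=> r u u1.
  rewrite -(f0 ((r * Re u, r * Im u), r ^+ 2)); last first.
    rewrite /paraboloid /= !exprMn -mulrDr -normc_sqr u1; ring.
  apply: eq_cintegral => x _; congr (expi (- _) * _).
  by rewrite /dot3 ReM; case: u {u1} => a b /=; ring.
- exact: multiplier_conj.
- by move=> x Sx; rewrite normc_conj; exact: normc_horizontal_le1.
- move=> r u u1.
  rewrite -(f0 ((r * Re u, - (r * Im u)), r ^+ 2)); last first.
    rewrite /paraboloid /= sqrrN !exprMn -mulrDr -normc_sqr u1; ring.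
  apply: eq_cintegral => x _; congr (expi (- _) * _).
  by rewrite /dot3 ReM; case: u {u1} => a b /=; ring.
Qed.

End sphere_integrals.

(** * Positivity of integrals in polar coordinates *)

Section polar_positivity.
Context {R : realType}.
Local Notation R2 := (measurableTypeR R * measurableTypeR R)%type.
Local Notation lebesgue2 := ((@lebesgue_measure R) \x (@lebesgue_measure R))%E.

Let lebesgue2X (A B : set (measurableTypeR R)) : measurable A -> measurable B ->
  (lebesgue2 (A `*` B) = lebesgue_measure A * lebesgue_measure B)%E.
Proof. by move=> mA mB; rewrite product_measure1E. Qed.

Lemma polar_measure_dom_lty : ((@polar_measure R) polar_dom < +oo)%E.
Proof.
rewrite /polar_measure setIid.
have c0 : 0 <= (4 * pi : R)^-1 by rewrite invr_ge0 mulr_ge0 ?pi_ge0.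
apply: (@le_lt_trans _ _ (\int[lebesgue2]_(t in @polar_dom R) ((4 * pi)^-1)%:E)%E).
  apply: ge0_le_integral => //.
  - exact: measurable_polar_dom.
  - by move=> t tD; rewrite lee_fin polar_density_ge0.
  - apply/measurable_EFinP; apply: measurable_funTS.
    exact: measurable_polar_density.
  - by move=> t _; rewrite lee_fin /polar_density ler_piMl// sin_le1.
rewrite integral_cst; last exact: measurable_polar_dom.
rewrite [X in (_ * X)%E](lebesgue2X _ _)// !lebesgue_measure_itv /=.
by do 2 case: ifP => _; rewrite ?mul0e ?mule0// -?EFinB -?EFinM ltry.
Qed.

(** If the integral vanished, [u] would vanish almost everywhere for
    [polar_measure], whose density is positive for 0 < theta < pi; but the
    remaining rectangle, a finite union of lines taken away, has positive
    Lebesgue measure. *)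
Lemma Rintegral_polar_gt0 (u : R2 -> R) (s : seq R) :
  measurable_fun setT u -> (forall t, 0 <= u t) ->
  (exists M, forall t, u t <= M) ->
  (forall t : R2, 0 < t.1 < pi -> t.1 \notin s -> u t != 0) ->
  0 < \int[@polar_measure R]_(t in polar_dom) u t.
Proof.
move=> mu u0 [M uM] us.
have mP := @measurable_polar_dom R.
have iu : (@polar_measure R).-integrable polar_dom (EFin \o u).
  apply: measurable_bounded_integrable => //.
  - exact: polar_measure_dom_lty.
  - exact: measurable_funTS.
  - exists M; split; first exact: num_real.
    by move=> N MN t _ /=; rewrite ger0_norm//; apply: le_trans (uM t) (ltW MN).
rewrite lt_neqAle Rintegral_ge0 ?andbT; last by move=> t _; exact: u0.
apply/eqP => int0.
have {}int0 : (\int[@polar_measure R]_(t in polar_dom) `|(u t)%:E| = 0)%E.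
  have -> : (\int[@polar_measure R]_(t in polar_dom) `|(u t)%:E| =
      \int[@polar_measure R]_(t in polar_dom) (u t)%:E)%E.
    by apply: eq_integral => t _; rewrite gee0_abs// lee_fin.
  by rewrite -[LHS]fineK ?integrable_fin_num//; congr EFin.
have mu' : measurable_fun (@polar_dom R) (EFin \o u).
  by apply/measurable_EFinP; exact: measurable_funTS.
have [N [mN N0 subN]] := (ae_eq_integral_abs (@polar_measure R) mP mu').1 int0.
have mNP : measurable (N `&` polar_dom) by exact: measurableI.
have md : measurable_fun (N `&` @polar_dom R) (EFin \o @polar_density R).
  by apply/measurable_EFinP/measurable_funTS; exact: measurable_polar_density.
have dN0 : (\int[lebesgue2]_(t in N `&` @polar_dom R) `|(polar_density t)%:E| = 0)%E.
  transitivity ((@polar_measure R) N); last exact: N0.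
  apply: eq_integral => t /set_mem[_ tD].
  by rewrite gee0_abs// lee_fin polar_density_ge0.
have [N2 [mN2 N20 subN2]] := (ae_eq_integral_abs lebesgue2 mNP md).1 dN0.
pose I0pi : set R := `]0, pi[%classic.
pose I02pi : set R := `[0, 2 * pi[%classic.
pose A : set R := I0pi `\` [set` s].
have ms : measurable [set` s].
  by apply: countable_measurable => //; exact/finite_set_countable/finite_seq.
have mI : measurable I0pi by exact: measurable_itv.
have mI2 : measurable I02pi by exact: measurable_itv.
have mA : measurable A by exact: measurableD.
have AN2 : A `*` I02pi `<=` N2.
  move=> [a b] [[/= a0pi as_] b2pi]; apply: subN2 => /=.
  rewrite /I0pi /= in_itv /= in a0pi.
  have D : polar_dom (a, b).
    split => //=; rewrite in_itv /=; case/andP: a0pi => ? ?.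
    by rewrite !ltW.
  have Nab : N (a, b).
    apply: subN => /= /(_ D) [] /eqP; apply/negP; apply: us => //=.
    exact/negP.
  move=> /(_ (conj Nab D)) [] /eqP; apply/negP.
  rewrite /polar_density mulf_neq0 ?invr_eq0 ?mulf_neq0 ?gt_eqF ?pi_gt0//=.
  exact: sin_gt0_pi.
have : (lebesgue2 (A `*` I02pi) <= lebesgue2 N2)%E.
  by apply: le_measure => //; rewrite inE//; exact: measurableX.
rewrite N20 lebesgue2X// lebesgue_measure_itv /= lte_fin.
have pi0 := pi_gt0 R; have pi20 : 0 < 2 * pi :> R by rewrite mulr_gt0.
rewrite pi20 -EFinB subr0 pmule_lle0 ?lte_fin// => A0.
have : (@lebesgue_measure R I0pi <=
    lebesgue_measure A + lebesgue_measure [set` s])%E.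
  apply: le_trans (measureU2 _ _ _) => //.
  apply: le_measure; rewrite ?inE//; first exact: measurableU.
  move=> x x0pi; have [xs|xs] := pselect ([set` s] x); first by right.
  by left.
rewrite (countable_lebesgue_measure0 (finite_set_countable (finite_seq s))).
rewrite adde0 => /le_trans /(_ A0); rewrite lebesgue_measure_itv /= lte_fin pi0 -EFinB subr0.
by rewrite lee_fin leNgt pi0.
Qed.

End polar_positivity.

(** * Associated Legendre functions *)

Section legendre.
Context {R : realType}.
Local Notation R2 := (measurableTypeR R * measurableTypeR R)%type.
Local Notation R3 := (R * R * R)%type.

Lemma size_derivn_legendre k m : (m <= k)%N ->
  size ((legendre k : {poly R})^`(m)) = (k - m).+1.
Proof.
move=> mk; rewrite size_derivn /legendre size_scale; last first.
  by rewrite invr_eq0 mulf_neq0 ?expf_neq0 ?pnatr_eq0// -lt0n fact_gt0.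
have s2 : size ('X^2 - 1 : {poly R}) = 3 by rewrite size_XnsubC.
have X0 : ('X^2 - 1 : {poly R}) != 0 by rewrite -size_poly_eq0 s2.
have := size_exp ('X^2 - 1 : {poly R}) k; rewrite s2 /= => sk.
have : size (('X^2 - 1 : {poly R}) ^+ k) != 0 by rewrite size_poly_eq0 expf_neq0.
rewrite size_derivn -lt0n; move: sk; case: (size _) => // s /= -> _; lia.
Qed.

(** A sequence of polynomials of degrees 0, 1, 2, ... is a basis. *)
Lemma poly_size_ind (q : nat -> {poly R}) (P : {poly R} -> Prop) :
  (forall d, size (q d) = d.+1) -> P 0 ->
  (forall d (c : R) p, P p -> P (p + c *: q d)) -> forall p, P p.
Proof.
move=> sq P0 PD p; have [n] := ubnP (size p); elim: n p => // n ih p.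
rewrite ltnS => pn; have [->//|p0] := eqVneq p 0.
have [d pd] : exists d, size p = d.+1.
  by case: (size p) (size_poly_eq0 p) => [|d _]; [rewrite (negPf p0)|exists d].
pose c := lead_coef p / lead_coef (q d).
have q0 : lead_coef (q d) != 0 by rewrite lead_coef_eq0 -size_poly_eq0 sq.
rewrite -(subrK (c *: q d) p); apply: PD; apply: ih.
apply: leq_trans pn; rewrite pd ltnS.
apply/leq_sizeP => j; rewrite leq_eqVlt => /orP[/eqP<-|dj].
  rewrite coefB coefZ /c !lead_coefE pd sq /=.
  by rewrite divfK ?subrr//; move: q0; rewrite lead_coefE sq.
by rewrite coefB coefZ !nth_default ?pd ?sq ?mulr0 ?subr0.
Qed.

(** The sectoral harmonics: on S^2 the factor (sin theta)^|l| e^(- i l phi) of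
    the conjugate of Y_k^l is a power of x - iy or of x + iy, according to the
    sign of l. *)
Definition sectoral (l : int) (x : R3) : R[i] :=
  match l with
  | Posz m => conjc (horizontal x) ^+ m
  | Negz m => horizontal x ^+ m.+1
  end.

Definition legendre_factor k l : R :=
  match l with
  | Posz m => (-1) ^+ m
  | Negz m => (-1) ^+ m.+1 * ((k - m.+1)`!%:R / (k + m.+1)`!%:R) * (-1) ^+ m.+1
  end.

Lemma legendre_factor_neq0 k l : legendre_factor k l != 0.
Proof.
by case: l => m /=; rewrite ?mulf_neq0 ?invr_eq0 ?expf_neq0 ?oppr_eq0 ?oner_eq0
  ?pnatr_eq0// -lt0n fact_gt0.
Qed.

Lemma assoc_legendre_cos k l (theta : R) : 0 <= theta <= pi ->
  assoc_legendre k l (cos theta) = legendre_factor k l *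
    (sin theta ^+ `|l| * ((legendre k)^`(`|l|)).[cos theta]).
Proof.
move=> thetapi.
have sE : Num.sqrt (1 - cos theta ^+ 2) = sin theta.
  rewrite -(cos2Dsin2 theta) addrAC subrr add0r sqrtr_sqr ger0_norm//.
  exact: sin_ge0_pi.
by case: l => m; rewrite /assoc_legendre /ferrers sE /=; ring.
Qed.

Lemma horner_bounded (p : {poly R}) (x : R) : `|x| <= 1 ->
  `|p.[x]| <= \sum_(i < size p) `|p`_i|.
Proof.
move=> x1; rewrite horner_coef; apply: le_trans (ler_norm_sum _ _ _) _.
apply: ler_sum => i _; rewrite normrM normrX; apply: ler_piMr => //.
exact: exprn_ile1.
Qed.

Lemma normc_harmonic (P : R -> R) l (t : R * R) :
  normc (harmonic_of P l t) = `|P (cos t.1)|.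
Proof. by rewrite Normc.normcM normc_expi mul1r normc_real. Qed.

(** The normalization is the inverse of an integral, hence could be 0 by
    convention; that integral is positive because a nonzero polynomial in
    cos theta has finitely many zeros. *)
Lemma legendre_norm_neq0 k l : (`|l| <= k)%N -> legendre_norm k l != 0 :> R.
Proof.
move=> lk; rewrite /legendre_norm invr_eq0 sqrtr_eq0 -ltNge.
pose m := `|l|%N; pose q : {poly R} := (legendre k)^`(m).
pose c : R := legendre_factor k l.
pose u (t : R2) : R := (c * (sin t.1 ^+ m * q.[cos t.1])) ^+ 2.
rewrite (_ : \int[_]_(t in _) _ =
  \int[@polar_measure R]_(t in polar_dom) u t); last first.
  apply: eq_Rintegral => t /set_mem[t1 _].
  rewrite normc_harmonic real_normK ?num_real// assoc_legendre_cos//.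
have q0 : q != 0 by rewrite -size_poly_eq0 size_derivn_legendre.
have cu : continuous (fun x : R => (c * (sin x ^+ m * q.[cos x])) ^+ 2).
  move=> x; apply: (@continuous_comp _ _ _
    (fun x : R => c * (sin x ^+ m * q.[cos x])) (fun y => y ^+ 2)).
    2: exact: exprn_continuous.
  apply: cvgM; first exact: cvg_cst.
  apply: cvgM.
    by apply: (@continuous_comp _ _ _ sin (fun y : R => y ^+ m));
      [exact: continuous_sin|exact: exprn_continuous].
  by apply: (@continuous_comp _ _ _ cos (horner q));
    [exact: continuous_cos|exact: continuous_horner].
apply: (@Rintegral_polar_gt0 _ _ [seq acos x | x <- roots q (-2) 2]).
- apply: (@measurableT_comp _ _ _ _ _ _
    ((fun x => (c * (sin x ^+ m * q.[cos x])) ^+ 2) : measurableTypeR R -> R)).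
    exact: (continuous_measurable_fun cu).
  exact: measurable_fst.
- by move=> t; exact: sqr_ge0.
- exists ((`|c| * \sum_(i < size q) `|q`_i|) ^+ 2) => t.
  rewrite /u -[leLHS]real_normK ?num_real// lerXn2r ?nnegrE ?mulr_ge0 ?sumr_ge0//.
  rewrite normrM ler_wpM2l// normrM -[leRHS]mul1r ler_pM//.
    by rewrite normrX exprn_ile1// ler_norml sin_geN1 sin_le1.
  by apply: horner_bounded; rewrite ler_norml cos_geN1 cos_le1.
- move=> t /andP[t0 tpi] ts.
  have s0 : 0 < sin t.1 by apply: sin_gt0_pi; rewrite t0.
  rewrite /u expf_neq0// !mulf_neq0 ?legendre_factor_neq0 ?expf_neq0 ?(gt_eqF s0)//.
  apply: contra ts => qt; apply/mapP; exists (cos t.1); last first.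
    by rewrite cosK// in_itv /= !ltW.
  apply: root_in_roots => //.
  by rewrite in_itv /=; have := cos_geN1 t.1; have := cos_le1 t.1; lra.
Qed.

Lemma sectoral_polar l (t : R * R) :
  sectoral l (polar t) = (sin t.1 ^+ `|l|)%:C%C * conjc (expi (l%:~R * t.2)).
Proof.
have hE : horizontal (polar t) = (sin t.1)%:C%C * expi t.2.
  by apply: complexP; rewrite ?ReM ?ImM /=; ring.
have conj_expi (x : R) : conjc (expi x) = expi (- x) by rewrite /expi cosN sinN.
have conjM (x y : R[i]) : conjc (x * y) = conjc x * conjc y by exact: rmorphM.
have conjX (x : R[i]) m : conjc (x ^+ m) = conjc x ^+ m by exact: rmorphXn.
have realX (a : R) m : (a ^+ m)%:C%C = a%:C%C ^+ m by exact: rmorphXn.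
have conjE (m : nat) : conjc (horizontal (polar t)) ^+ m =
    (sin t.1 ^+ m)%:C%C * conjc (expi (m%:R * t.2)).
  by rewrite hE expiM_natl conjM conjX conjc_real exprMn realX.
case: l => m; first by rewrite -[(Posz m)%:~R]pmulrn; exact: conjE.
have -> : (Negz m)%:~R = - m.+1%:R :> R by rewrite NegzE mulrNz -pmulrn.
by rewrite mulNr -conj_expi conjcK expiM_natl /sectoral hE exprMn realX.
Qed.

Lemma multiplier_sectoral l : multiplier (@sphere R) (sectoral l).
Proof.
have mh := multiplier_horizontal (@sphere_bounded R).
by case: l => m; apply: multiplierX => //; exact: multiplier_conj.
Qed.

Lemma multiplier_height (p : {poly R}) :
  multiplier (@sphere R) (fun x => (p.[x.2])%:C%C).
Proof.
apply: multiplier_real.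
  apply: measurable_funTS.
  apply: (@measurableT_comp _ _ _ _ _ _ (horner p : measurableTypeR R -> R)).
    exact: (continuous_measurable_fun (@continuous_horner R p)).
  exact: measurable_snd.
exists (\sum_(i < size p) `|p`_i|) => x /sphere_coord_le1[_ _ x1].
exact: horner_bounded.
Qed.

Lemma harmonic_coefE k l (f : R3 -> R[i]) : @L1_sphere R f ->
  harmonic_coef k l f =
  cintegral (@sphere_measure R) sphere
    (fun x => f x * (sectoral l x * (((legendre k)^`(`|l|)).[x.2])%:C%C)) *
  (legendre_norm k l * legendre_factor k l)%:C%C.
Proof.
move=> fi; have mS := @measurable_sphere R.
have mg := multiplierM (multiplier_sectoral l)
  (multiplier_height (legendre k)^`(`|l|)).
have ifg := cintegrableM mS fi mg.
rewrite -(cintegralZ mS _ ifg) cintegral_sphere; last first.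
  by apply: cintegrableM => //; exact: multiplier_cst.
apply: eq_cintegral => t [/= t1 _]; rewrite -mulrA; congr (_ * _).
rewrite /sph_harmonic /harmonic_of /normalized_legendre.
rewrite assoc_legendre_cos; last by move: t1; rewrite in_itv.
rewrite sectoral_polar; apply: complexP; rewrite !(ReM, ImM) /=; ring.
Qed.

End legendre.

(** * Vanishing of all harmonic moments *)

Section harmonic_moments.
Context {R : realType}.
Local Notation R3 := (R * R * R)%type.
Variable f : R3 -> R[i].
Hypothesis f_sym : @L1_sym R f.
Hypothesis f_vanish : forall xi, paraboloid xi -> fourier_sphere f xi = 0.

Let fi : cintegrable (@sphere_measure R) sphere f. Proof. by case: f_sym. Qed.
Let mS := @measurable_sphere R.

Lemma sectoral_moment_eq0 l :
  cintegral (@sphere_measure R) sphere (fun x => f x * sectoral l x) = 0.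
Proof.
case: l => m.
- exact: (paraboloid_power_moments m fi f_vanish).2.
- exact: (paraboloid_power_moments m.+1 fi f_vanish).1.
Qed.

(** For k = |l| the function P_k^l is a multiple of (sin theta)^|l|, so the
    coefficient is a power moment; the symmetry of [f] propagates its vanishing
    to all k. *)
Lemma harmonic_coef_eq0 k l : (`|l| <= k)%N -> harmonic_coef k l f = 0.
Proof.
move=> lk; have [_ /(_ k `|l|%N l)] := f_sym.
rewrite leq_min lk leqnn => /(_ isT) ->.
have /eqP := @size_derivn_legendre R `|l| `|l| (leqnn _).
rewrite subnn => /size_poly1P[c _ pc].
rewrite harmonic_coefE// pc; under eq_fun do rewrite hornerC mulrA.
rewrite (cintegralZ mS); last first.
  by have := cintegrableM mS fi (multiplier_sectoral l).
by rewrite sectoral_moment_eq0 !mul0r.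
Qed.

(** The polynomials that accompany the sectoral harmonic of order l in Y_k^l,
    for k = |l|, |l| + 1, ..., have degrees 0, 1, ... *)
Lemma sectoral_poly_moment_eq0 l (p : {poly R}) :
  cintegral (@sphere_measure R) sphere
    (fun x => f x * (sectoral l x * (p.[x.2])%:C%C)) = 0.
Proof.
have ifp q := cintegrableM mS fi
  (multiplierM (multiplier_sectoral l) (multiplier_height q)).
move: p; apply: (@poly_size_ind _ (fun d => (legendre (`|l| + d))^`(`|l|))).
- by move=> d; rewrite size_derivn_legendre ?leq_addr// addKn.
- under eq_fun do rewrite horner0 !mulr0; exact: cintegral0.
- move=> d c p ih.
  have lk : (`|l| <= `|l| + d)%N by exact: leq_addr.
  have := harmonic_coef_eq0 lk; rewrite harmonic_coefE// => /eqP.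
  rewrite mulf_eq0 => /orP[/eqP qd0|]; last first.
    rewrite eq_complex /= eqxx andbT.
    by rewrite mulf_eq0 (negPf (legendre_norm_neq0 lk))
      (negPf (legendre_factor_neq0 _ _)).
  rewrite (@eq_cintegral _ _ _ _ _ _ (fun x =>
      f x * (sectoral l x * (p.[x.2])%:C%C) +
      f x * (sectoral l x * (((legendre (`|l| + d))^`(`|l|)).[x.2])%:C%C) *
      c%:C%C)).
    rewrite cintegralD// ?cintegralZ//; first by rewrite ih qd0 mul0r addr0.
    by apply: cintegrableM => //; exact: multiplier_cst.
  move=> x _; rewrite hornerD hornerZ rmorphD rmorphM /=; ring.
Qed.

(** On S^2 the common powers of x + iy and x - iy combine into powers of
    1 - z^2. *)
Lemma mixed_moment_eq0 a b j :
  cintegral (@sphere_measure R) sphere (fun x => f x * mixed_monomial a b j x) = 0.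
Proof.
pose l : int := if (a <= b)%N then Posz (b - a) else Negz (a - b).-1.
pose p : {poly R} := (1 - 'X^2) ^+ (minn a b) * 'X^j.
rewrite -(sectoral_poly_moment_eq0 l p); apply: eq_cintegral => x Sx.
congr (_ * _).
have pE : (p.[x.2])%:C%C = (1 - vertical x ^+ 2) ^+ (minn a b) * vertical x ^+ j.
  rewrite /p !hornerE /vertical.
  by rewrite rmorphM !rmorphXn rmorphB rmorph1 rmorphXn.
rewrite pE mulrA -(horizontal_conj Sx) /mixed_monomial; congr (_ * _).
rewrite /l exprMn; have [ab|ba] := leqP a b.
  by rewrite /= mulrCA -exprD subnK.
by rewrite /= prednK ?subn_gt0// mulrA -exprD subnK// ltnW.
Qed.

End harmonic_moments.

Theorem theorem4p2 (R : realType) :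
  heisenberg_uniqueness_pair (@paraboloid R) (@L1_sym R).
Proof.
move=> f f_sym f_vanish A mA; have [fi _] := f_sym.
apply: (moment_uniqueness (@measurable_sphere R) (@sphere_bounded R) fi) => //.
by move=> a b j; exact: mixed_moment_eq0.
Qed.
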